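(* Let $k\geq 1$, let $K\subseteq \mathbb{R}^k$, and let $\epsilon\geq 0$ and $\delta>0$ satisfy $2\delta+\epsilon<1$. Let \begin{align*} G=\{(x,r)\in\mathbb{R}^k\times\mathbb{R}^+ :\ & 0<r<d(x,K),\text{ and there exist }z_1,z_2\in K \text{ such that } d(x,z_1)\leq d(x,K)+\epsilon r,\\ & d(x,z_2)\leq d(x,K)+\epsilon r, \text{ but } |\theta|>\cos^{-1}\left(2\left(\frac{1-(2\delta +\epsilon)}{1+2\delta}\right)^2-1\right)\}, \end{align*} where $\theta$ is the angle between the segments $[x,z_1]$ and $[x,z_2]$. Then $G$ is a Carleson set, and its Carleson constant is bounded above by a constant depending only on $\delta$ and $k$.
   Context: $d(p,q)=|p-q|$ is the Euclidean distance on $\mathbb{R}^k$, and $d(p,K)=\inf\{d(p,x):x\in K\}$. $\mathbb{R}^+$ denotes the positive reals. For a measurable $D\subseteq \mathbb{R}^k\times\mathbb{R}^+$ write $D_r=\{x:(x,r)\in D\}$. $D$ is a Carleson set if there is $C\geq 0$ such that for every $L>0$ and every ball $B\subseteq\mathbb{R}^k$ of radius $L$, $\int_0^L |D_r\cap B|\,\frac{dr}{r}\leq C|B|$, where $|\cdot|$ is Lebesgue measure on $\mathbb{R}^k$; the minimal such $C$ is the Carleson constant of $D$. *)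

(* Defs.v *)
From HB Require Import structures.
From mathcomp Require Import all_boot all_order all_algebra.
From mathcomp Require Import all_classical all_reals all_analysis.

Set Implicit Arguments.
Unset Strict Implicit.
Unset Printing Implicit Defensive.

Import Order.TTheory GRing.Theory Num.Theory.
Import numFieldNormedType.Exports.

Local Open Scope classical_set_scope.
Local Open Scope ring_scope.

Section Defs.
Variable R : realType.

Definition edot (n : nat) (u v : 'rV[R]_n) : R := \sum_(i < n) u 0 i * v 0 i.
Definition enorm (n : nat) (u : 'rV[R]_n) : R := Num.sqrt (edot u u).

(* Euclidean distance from a point to a set, d(p,K) = inf {|p - z| : z in K};
   valued in extended reals so that d(p, emptyset) = +oo. *)
Definition edist_set (n : nat) (p : 'rV[R]_n) (K : set 'rV[R]_n) : \bar R :=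
  ereal_inf [set (enorm (p - z))%:E | z in K].

Definition seg_angle (n : nat) (x z1 z2 : 'rV[R]_n) : R :=
  acos (edot (z1 - x) (z2 - x) / (enorm (z1 - x) * enorm (z2 - x))).

Definition eball (n : nat) (c : 'rV[R]_n) (L : R) : set 'rV[R]_n :=
  [set y | enorm (y - c) < L].

Definition box (n : nat) (a b : 'rV[R]_n) : set 'rV[R]_n :=
  [set x | forall i : 'I_n, a 0 i <= x 0 i <= b 0 i].
Definition box_vol (n : nat) (a b : 'rV[R]_n) : R :=
  \prod_(i < n) Num.max (b 0 i - a 0 i) 0.

Definition leb_outer (n : nat) (A : set 'rV[R]_n) : \bar R :=
  ereal_inf [set s | exists a b : nat -> 'rV[R]_n,
    A `<=` \bigcup_j box (a j) (b j) /\
    s = (\sum_(0 <= j <oo) (box_vol (a j) (b j))%:E)%E].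

Definition leb_measurable (n : nat) (E : set 'rV[R]_n) : Prop :=
  forall A : set 'rV[R]_n,
    leb_outer A = (leb_outer (A `&` E) + leb_outer (A `&` ~` E))%E.

Definition pt (k : nat) (x : 'rV[R]_k) (r : R) : 'rV[R]_(k + 1) :=
  row_mx x (const_mx r).

Definition slice (k : nat) (D : set ('rV[R]_k * R)) (r : R) : set 'rV[R]_k :=
  [set x | D (x, r)].

Definition carleson_with_const (k : nat) (D : set ('rV[R]_k * R)) (C : R) : Prop :=
  [/\ D `<=` [set p | 0 < p.2],
      leb_measurable [set pt p.1 p.2 | p in D],
      0 <= C &
      forall (L : R) (c : 'rV[R]_k), 0 < L ->
        (\int[lebesgue_measure]_(r in `]0%R, L[%classic)
            (leb_outer (slice D r `&` eball c L) * (r^-1)%:E)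
         <= C%:E * leb_outer (eball c L))%E].

Definition setG (k : nat) (K : set 'rV[R]_k) (eps delta : R) : set ('rV[R]_k * R) :=
  [set p | let x := p.1 in let r := p.2 in
    [/\ 0 < r, (r%:E < edist_set x K)%E &
      exists z1 z2, [/\ K z1, K z2,
        ((enorm (x - z1))%:E <= edist_set x K + (eps * r)%:E)%E,
        ((enorm (x - z2))%:E <= edist_set x K + (eps * r)%:E)%E &
        acos (2 * ((1 - (2 * delta + eps)) / (1 + 2 * delta)) ^+ 2 - 1)
          < `|seg_angle x z1 z2| ]]].

End Defs.

(* Main.v *)
(** Let [f x = d(x,K)]. Near-minimizers at nearby points are almost monotone: if [z], [z'] in [K]
    almost realize [f x], [f x'] up to [r], then [(x' - x).(z' - z) >= - 3/2 (f x + f x') r], because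
    [|x|^2 - f(x)^2] is a supremum of affine functions of slope [2z].  A point of the slice [G_r] has
    two near-minimizers at distance at least [c f x], [c] depending only on [delta].

    On a cube of side [l] where [f] is almost constant, follow a line of a grid of mesh about [r]:
    each time the line meets [G_r], one coordinate of the near-minimizers must advance by a fixed
    fraction of [f], while it is confined to an interval of length [O(f)].  So each line meets [G_r]
    boundedly often, and [G_r] fills at most a fraction [O(r/l)] of the cube.  Cubes on which [f] is
    not almost constant satisfy [f = O(l)]; they are halved until [f] is large compared with the side.
    Since [r < f] on [G_r], a final cube only matters for scales [r = O(l)], and summing [r/l] over
    dyadic [r] gives a bounded multiple of its volume; the volumes of the final cubes add up to that of
    the initial one.

    For [eps > 0], [G] is an open set up to a set which vertical translations push into it, hence up
    to a null set.  For [eps = 0] the slices increase as [r] decreases, so the estimate makes them null. *)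

Require Import Defs.
From HB Require Import structures.
From mathcomp Require Import all_boot all_order all_algebra.
From mathcomp Require Import all_classical all_reals all_analysis.
From mathcomp Require Import measurable_realfun.
From mathcomp Require Import ring lra.

Set Implicit Arguments.
Unset Strict Implicit.
Unset Printing Implicit Defensive.

Import Order.TTheory GRing.Theory Num.Theory.
Import numFieldNormedType.Exports.

Local Open Scope classical_set_scope.
Local Open Scope ring_scope.

(** * Lebesgue outer measure *)

Section LebesgueOuterMeasure.
Variables (R : realType) (n : nat).
Implicit Types (a b x : 'rV[R]_n.+1) (A : set 'rV[R]_n.+1).

Lemma box_vol_ge0 (m : nat) (u v : 'rV[R]_m) : 0 <= box_vol u v.
Proof. by apply: prodr_ge0 => i _; rewrite le_max lexx orbT. Qed.

(** False in dimension 0, where the empty product is 1; hence the [n.+1] in this section. *)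
Lemma box_vol_xx a : box_vol a a = 0.
Proof. by rewrite /box_vol big_ord_recl subrr maxxx mul0r. Qed.

Lemma leb_outer_ge0 A : (0 <= leb_outer A)%E.
Proof.
apply: le_ereal_inf_tmp => _ [a [b [_ ->]]].
by apply: nneseries_ge0 => j _ _; rewrite lee_fin box_vol_ge0.
Qed.

Lemma le_leb_outer : {homo @leb_outer R n.+1 : A B / A `<=` B >-> (A <= B)%E}.
Proof.
move=> A B AB; apply: ereal_inf_le_tmp => s [a [b [Bab ->]]].
by exists a, b; split=> //; exact: subset_trans Bab.
Qed.

Lemma leb_outer_box a b : (leb_outer (box a b) <= (box_vol a b)%:E)%E.
Proof.
apply: ereal_inf_lbound.
exists (fun j => if j == 0%N then a else 0), (fun j => if j == 0%N then b else 0).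
split; first by move=> x abx; exists 0%N.
rewrite nneseries_recl//; last by move=> j _; rewrite lee_fin box_vol_ge0.
rewrite eseries0 ?adde0// => -[|j]// _ _.
by rewrite box_vol_xx.
Qed.

Lemma leb_outer0 : leb_outer (@set0 'rV[R]_n.+1) = 0%E.
Proof.
apply/eqP; rewrite eq_le leb_outer_ge0 andbT.
have := leb_outer_box 0 0; rewrite box_vol_xx; apply: le_trans.
exact: le_leb_outer.
Qed.

Lemma leb_outer_sigma_subadditive : sigma_subadditive (@leb_outer R n.+1).
Proof.
move=> A; have [[i ioo]|] := pselect (exists i, leb_outer (A i) = +oo%E).
  rewrite (eseries_pinfty _ _ ioo) ?leey// => j _.
  by rewrite -ltNye (lt_le_trans _ (leb_outer_ge0 _)).
rewrite -forallNE => Aoo.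
suff add2e (e : {posnum R}) :
    (leb_outer (\bigcup_n A n) <= \sum_(i <oo) leb_outer (A i) + e%:num%:E)%E.
  by apply/lee_addgt0Pr => _/posnumP[].
rewrite (le_trans _ (epsilon_trick _ _ _))//; last first.
  by move=> j; exact: leb_outer_ge0.
pose P j (B : nat -> 'rV[R]_n.+1 * 'rV[R]_n.+1) :=
  A j `<=` \bigcup_k box (B k).1 (B k).2 /\
  (\sum_(k <oo) (box_vol (B k).1 (B k).2)%:E <=
     leb_outer (A j) + (e%:num / (2 ^ j.+1)%:R)%:E)%E.
have [G PG] : {G & forall j, P j (G j)}.
  apply: (@choice _ _ P) => j.
  have en1 : (0 < e%:num / (2 ^ j.+1)%:R)%R by [].
  have Afin : leb_outer (A j) \is a fin_num.
    rewrite ge0_fin_numE ?leb_outer_ge0// ltey.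
    by apply/eqP; exact: Aoo.
  have [_ [a [b [Aab ->]]] /ltW abS] := lb_ereal_inf_adherent en1 Afin.
  by exists (fun k => (a k, b k)).
pose v (p : nat * nat) : \bar R := (box_vol (G p.1 p.2).1 (G p.1 p.2).2)%:E.
have v0 p : (0 <= v p)%E by rewrite lee_fin box_vol_ge0.
apply: (@le_trans _ _ (\sum_(i <oo) \sum_(j <oo) v (i, j))%E); last first.
  by apply: lee_nneseries => j _; [move=> *; exact: nneseries_ge0 | case: (PG j)].
have -> : (\sum_(i <oo) \sum_(j <oo) v (i, j) =
    \esum_(i in [set: nat]) \esum_(j in [set: nat]) v (i, j))%E.
  rewrite nneseries_esumT; last by move=> i; exact: nneseries_ge0.
  by apply: eq_esum => i _; rewrite nneseries_esumT.
rewrite (@esum_esum _ _ _ _ (fun=> setT) (fun i j => v (i, j)))//.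
(* A bijection from [nat] to [nat * nat] merges the covers [G j] into one sequence of boxes. *)
have /card_esym/ppcard_eqP[f] := card_nat2.
rewrite [leRHS](_ : _ = \esum_(p in [set: nat * nat]) v p)%E; last first.
  rewrite (_ : _ `*`` _ = setT); last by apply/seteqP.
  by apply: eq_esum => -[].
rewrite (@reindex_esum _ _ _ [set: nat] _ f)// -nneseries_esumT//.
apply: ereal_inf_lbound.
exists (fun k => (G (f k).1 (f k).2).1), (fun k => (G (f k).1 (f k).2).2).
split=> // x [i _ /(PG i).1[j _ xij]].
by exists (f^-1%FUN (i, j)) => //; rewrite invK ?inE.
Qed.

HB.instance Definition _ := isOuterMeasure.Build R 'rV[R]_n.+1
  (@leb_outer R n.+1) leb_outer0 leb_outer_ge0 le_leb_outer
  leb_outer_sigma_subadditive.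

Lemma leb_outer_bigU (I : finType) (P : pred I) (F : I -> set 'rV[R]_n.+1) :
  (leb_outer (\big[setU/set0]_(i | P i) F i) <= \sum_(i | P i) leb_outer (F i))%E.
Proof.
elim/big_ind2 : _ => [|A x B y Ax By|i _]; rewrite ?leb_outer0//.
by apply: le_trans (leeD Ax By); exact: outer_measureU2.
Qed.

Lemma leb_outer_null_bigcup (F : nat -> set 'rV[R]_n.+1) :
  (forall j, leb_outer (F j) = 0%E) -> leb_outer (\bigcup_j F j) = 0%E.
Proof.
move=> F0; apply/eqP; rewrite eq_le leb_outer_ge0 andbT.
by rewrite (le_trans (leb_outer_sigma_subadditive _))// eseries0.
Qed.

Lemma leb_outer_subset_null A B :
  A `<=` B -> leb_outer B = 0%E -> leb_outer A = 0%E.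
Proof.
by move=> /le_leb_outer AB B0; apply/eqP; rewrite eq_le leb_outer_ge0 -B0 AB.
Qed.

Lemma leb_measurable_null A : leb_outer A = 0%E -> leb_measurable A.
Proof.
move=> A0; apply: (@le_caratheodory_measurable _ _ (@leb_outer R n.+1)) => X.
change (leb_outer (X `&` A) + leb_outer (X `&` ~` A) <= leb_outer X)%E.
have -> : leb_outer (X `&` A) = 0%E by apply: leb_outer_subset_null A0 => x [].
by rewrite add0e; apply: le_leb_outer => x [].
Qed.

Lemma leb_measurableC A : leb_measurable A -> leb_measurable (~` A).
Proof. exact: (@caratheodory_measurable_setC _ _ (@leb_outer R n.+1)). Qed.

Lemma leb_measurableU A B :
  leb_measurable A -> leb_measurable B -> leb_measurable (A `|` B).
Proof. exact: (@caratheodory_measurable_setU _ _ (@leb_outer R n.+1)). Qed.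

Lemma leb_measurableI A B :
  leb_measurable A -> leb_measurable B -> leb_measurable (A `&` B).
Proof. exact: (@caratheodory_measurable_setI _ _ (@leb_outer R n.+1)). Qed.

Lemma leb_measurable_bigcup (F : nat -> set 'rV[R]_n.+1) :
  (forall j, leb_measurable (F j)) -> leb_measurable (\bigcup_j F j).
Proof. exact: (@caratheodory_measurable_bigcup _ _ (@leb_outer R n.+1)). Qed.

Definition setcoord (x : 'rV[R]_n.+1) (i : 'I_n.+1) (c : R) : 'rV[R]_n.+1 :=
  \row_j (if j == i then c else x 0 j).

Lemma max_min_split (u v c : R) :
  Num.max (Num.min v c - u) 0 + Num.max (v - Num.max u c) 0 <= Num.max (v - u) 0.
Proof.
(* Each [max] and [min] becomes an explicit case distinction, after which the claim is linear. *)
have mE (p q : R) : p <= q /\ Num.max p q = q /\ Num.min p q = p \/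
    q <= p /\ Num.max p q = p /\ Num.min p q = q.
  by case: (leP p q) => [|/ltW] pq; [left | right].
have := mE u c; have := mE v c; have := mE (v - u) 0.
have := mE (Num.min v c - u) 0; have := mE (v - Num.max u c) 0.
by lra.
Qed.

Lemma box_vol_split a b (i : 'I_n.+1) (c : R) :
  box_vol a (setcoord b i (Num.min (b 0 i) c)) +
  box_vol (setcoord a i (Num.max (a 0 i) c)) b <= box_vol a b.
Proof.
have volE (u v : 'rV[R]_n.+1) : box_vol u v = Num.max (v 0 i - u 0 i) 0 *
    \prod_(j < n.+1 | j != i) Num.max (v 0 j - u 0 j) 0.
  by rewrite /box_vol (bigD1 i).
rewrite !volE !mxE eqxx.
under eq_bigr => j /negbTE ji do rewrite mxE ji.
under [in X in _ + X]eq_bigr => j /negbTE ji do rewrite mxE ji.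
rewrite -mulrDl; apply: ler_wpM2r.
  by apply: prodr_ge0 => j _; rewrite le_max lexx orbT.
exact: max_min_split.
Qed.

(** The hyperplane cuts every box of a cover of [X] into two, which gives a cover of each side; by
    [box_vol_split] the total volume does not grow. *)
Lemma leb_measurable_halfspace (i : 'I_n.+1) (c : R) :
  leb_measurable [set x : 'rV[R]_n.+1 | x 0 i <= c].
Proof.
apply: (@le_caratheodory_measurable _ _ (@leb_outer R n.+1)) => X.
apply: le_ereal_inf_tmp => _ [a [b [Xab ->]]].
pose b' j := setcoord (b j) i (Num.min (b j 0 i) c).
pose a' j := setcoord (a j) i (Num.max (a j 0 i) c).
apply: (@le_trans _ _ (\sum_(0 <= j <oo) ((box_vol (a j) (b' j))%:E +
                        (box_vol (a' j) (b j))%:E))%E); last first.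
  apply: lee_nneseries => j _; first by rewrite -EFinD lee_fin addr_ge0 ?box_vol_ge0.
  by rewrite -EFinD lee_fin box_vol_split.
rewrite nneseriesD; try by move=> *; rewrite lee_fin box_vol_ge0.
apply: leeD; apply: ereal_inf_lbound.
- exists a, b'; split=> // x [/Xab[j _ xab] xc]; exists j => // l.
  have /andP[axl xbl] := xab l; rewrite axl/= !mxE; case: ifPn => // /eqP li.
  rewrite le_min; apply/andP; split; first by rewrite -li.
  by rewrite li.
- exists a', b; split=> // x [/Xab[j _ xab] /negP]; rewrite -ltNge => xc.
  exists j => // l; have /andP[axl xbl] := xab l; rewrite xbl andbT !mxE.
  by case: ifPn => // /eqP li; rewrite ge_max li (ltW xc) andbT -li.
Qed.

Lemma leb_measurable_box a b : leb_measurable (box a b).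
Proof.
have hs c i : leb_measurable [set x : 'rV[R]_n.+1 | c <= x 0 i].
  suff -> : [set x : 'rV[R]_n.+1 | c <= x 0 i] =
      \bigcap_j [set x : 'rV[R]_n.+1 | c - j.+1%:R^-1 < x 0 i].
    rewrite -(setCK (\bigcap__ _ _)) setC_bigcap; apply: leb_measurableC.
    apply: leb_measurable_bigcup => j.
    rewrite (_ : ~` _ = [set x : 'rV[R]_n.+1 | x 0 i <= c - j.+1%:R^-1]).
      exact: leb_measurable_halfspace.
    by apply/seteqP; split=> x /=; rewrite leNgt => /negP.
  apply/seteqP; split=> x /= cx.
    by move=> j _ /=; rewrite ltrBlDr (le_lt_trans cx)// ltrDl invr_gt0.
  rewrite leNgt; apply/negP => xc.
  have xc0 : 0 < c - x 0 i by rewrite subr_gt0.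
  have [j jc] := ltr_add_invr xc.
  have /= := cx j I; move: jc.
  by move: (j.+1%:R^-1) => t ? ?; lra.
(* [inord] lists the coordinates, with repetitions, along all of [nat], so that closure under
   countable unions applies. *)
have -> : box a b = ~` \bigcup_j ~` ([set x : 'rV[R]_n.+1 | a 0 (inord j) <= x 0 (inord j)]
    `&` [set x | x 0 (inord j) <= b 0 (inord j)]).
  rewrite setC_bigcup; apply/seteqP; split=> x /= abx.
    by move=> j _; rewrite setCK; apply/andP; apply: abx.
  by move=> i; have := abx i I; rewrite setCK inord_val => /andP.
apply/leb_measurableC/leb_measurable_bigcup => j; apply/leb_measurableC.
by apply: leb_measurableI; [exact: hs | exact: leb_measurable_halfspace].
Qed.

(** An open set is the union of the boxes inside it with rational centre and half-side [1/(j+1)],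
    which are countably many. *)
Lemma leb_measurable_open (U : set 'rV[R]_n.+1) : open U -> leb_measurable U.
Proof.
move=> oU.
pose bx (p : 'rV[rat]_n.+1 * nat) : set 'rV[R]_n.+1 :=
  box (map_mx ratr p.1 - const_mx p.2.+1%:R^-1)
      (map_mx ratr p.1 + const_mx p.2.+1%:R^-1).
pose F (m : nat) : set 'rV[R]_n.+1 :=
  if unpickle m is Some p then (if pselect (bx p `<=` U) then bx p else set0)
  else set0.
have -> : U = \bigcup_m F m.
  apply/seteqP; split=> [x Ux|x [m _]]; last first.
    rewrite /F; case: unpickle => // p; by case: pselect => // pU /pU.
  have [e /= e0 xeU] : exists2 e : R, 0 < e & ball x e `<=` U.
    by apply/nbhs_ballP; apply: open_nbhs_nbhs.
  have e20 : 0 < e / 2 by rewrite divr_gt0.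
  have [j je] : exists j : nat, j.+1%:R^-1 < e / 2.
    by have [j] := ltr_add_invr e20; rewrite add0r; exists j.
  have qP i : exists q : rat, x 0 i - j.+1%:R^-1 < ratr q < x 0 i + j.+1%:R^-1.
    have : x 0 i - j.+1%:R^-1 < x 0 i + j.+1%:R^-1.
      have : 0 < j.+1%:R^-1 :> R by rewrite invr_gt0.
      by move: (j.+1%:R^-1) => t t0; lra.
    by move=> /rat_in_itvoo[q]; rewrite in_itv/=; exists q.
  have [q {}qP] := choice qP.
  pose p : 'rV[rat]_n.+1 * nat := (\row_i q i, j).
  have xp : bx p x.
    move=> i; rewrite !mxE/=; have := qP i.
    by move: (j.+1%:R^-1) (ratr _) (x 0 i) => t u v /andP[? ?]; apply/andP; split; lra.
  exists (pickle p) => //; rewrite /F pickleK; case: pselect => //; apply.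
  move=> y py; apply: xeU; split=> // i0 i; rewrite ord1 /ball/=.
  have := py i; have := qP i; rewrite !mxE/= ltr_norml; move: je.
  move: (j.+1%:R^-1) (ratr _) (x 0 i) (y 0 i) => t u v w ? /andP[? ?] /andP[? ?].
  by apply/andP; split; lra.
apply: leb_measurable_bigcup => m; rewrite /F.
have m0 : leb_measurable (@set0 'rV[R]_n.+1).
  exact: (leb_measurable_null leb_outer0).
by case: (unpickle m) => // p; case: pselect => // pU; exact: leb_measurable_box.
Qed.

End LebesgueOuterMeasure.

Lemma leb_outer_fin_cover (R : realType) (n : nat) (I : finType) (P : pred I)
    (A : set 'rV[R]_n.+1) (F : I -> set 'rV[R]_n.+1) :
  (forall x, A x -> exists2 i, P i & F i x) ->
  (leb_outer A <= \sum_(i | P i) leb_outer (F i))%E.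
Proof.
move=> AF; apply: le_trans (leb_outer_bigU P F); apply: le_leb_outer => x /AF[i Pi Fx].
by rewrite (bigD1 i)//=; left.
Qed.

(** * Volume of boxes, translations and null sets *)

Section BoxVolume.
Variable R : realType.

(* A measure giving every box its volume bounds [leb_outer] from below without a compactness argument.
   It lives on an iterated product, [h] being the identification with ['rV_m]. *)
Lemma box_measure (m : nat) :
  exists (d : measure_display) (T : measurableType d)
    (mu : {measure set T -> \bar R}) (h : T -> 'rV[R]_m),
  forall a b, measurable (h @^-1` box a b) /\
    mu (h @^-1` box a b) = (box_vol a b)%:E.
Proof.
elim: m => [|m [d [T [mu [h hbox]]]]].
  exists _, unit, (dirac tt), (fun=> 0) => a b.
  have -> : (fun=> 0) @^-1` box a b = [set: unit].
    by apply/seteqP; split=> // x _ [].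
  split=> //; rewrite /box_vol big_ord0.
  exact: diracT.
pose h' (p : T * measurableTypeR R) : 'rV[R]_m.+1 :=
  \row_i oapp (h p.1 0) p.2 (unlift ord0 i).
exists _, (T * measurableTypeR R)%type, (mu \x (@lebesgue_measure R))%E, h' => a b.
pose tl (u : 'rV[R]_m.+1) : 'rV[R]_m := \row_j u 0 (lift ord0 j).
have -> : h' @^-1` box a b =
    (h @^-1` box (tl a) (tl b)) `*` `[a 0 ord0, b 0 ord0].
  apply/seteqP; split=> -[t r] /=.
    move=> abtr; split; first by move=> j; have := abtr (lift ord0 j); rewrite !mxE liftK.
    by have := abtr ord0; rewrite mxE unlift_none/= in_itv.
  move=> [abt abr] i; rewrite mxE; case: (unliftP ord0 i) => [j|] ->.
    by have := abt j; rewrite !mxE.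
  by move: abr; rewrite in_itv.
have [mh muh] := hbox (tl a) (tl b).
have mI : measurable (`[a 0 ord0, b 0 ord0]%classic : set (measurableTypeR R)).
  exact: measurable_itv.
split; first exact: measurableX.
transitivity (mu (h @^-1` box (tl a) (tl b)) *
    lebesgue_measure `[a 0%R ord0, b 0%R ord0]%classic)%E.
  exact: product_measure1E.
rewrite muh.
rewrite /box_vol big_ord_recl mulrC EFinM; congr (_ * _)%E.
  by congr (_%:E); apply: eq_bigr => j _; rewrite !mxE.
rewrite lebesgue_measure_itv/= lte_fin; case: ltP => ab.
  by rewrite -EFinD max_l// subr_ge0 ltW.
by rewrite max_r// subr_le0.
Qed.

(** Pulled back along the map of [box_measure], the claim is countable subadditivity of a
    measure. *)
Lemma box_vol_le_leb_outer (m : nat) (a b : 'rV[R]_m) :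
  ((box_vol a b)%:E <= leb_outer (box a b))%E.
Proof.
have [d [T [mu [h hbox]]]] := box_measure m.
apply: le_ereal_inf_tmp => _ [u [v [abuv ->]]].
have [mab <-] := hbox a b.
under eq_eseriesr => j _ do rewrite -(hbox (u j) (v j)).2.
apply: measure_sigma_subadditive => //.
- by move=> j; case: (hbox (u j) (v j)).
- by move=> t /abuv[j _ ?]; exists j.
Qed.

Lemma leb_outer_translate_le (m : nat) (A : set 'rV[R]_m) (v : 'rV[R]_m) :
  (leb_outer [set x : 'rV[R]_m | A (x + v)%R] <= leb_outer A)%E.
Proof.
apply: ereal_inf_le_tmp => s [a [b [Aab ->]]].
exists (fun j => a j - v), (fun j => b j - v); split=> [x /Aab[j _ xab]|].
  exists j => // i; have := xab i; rewrite !mxE.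
  by move=> /andP[? ?]; rewrite lerBlDr lerBrDr; apply/andP.
apply: eq_eseriesr => j _; congr (_%:E); apply: eq_bigr => i _.
by rewrite !mxE; congr (Num.max _ _); ring.
Qed.

Lemma leb_outer_translate (m : nat) (A : set 'rV[R]_m) (v : 'rV[R]_m) :
  leb_outer [set x : 'rV[R]_m | A (x + v)%R] = leb_outer A.
Proof.
apply/eqP; rewrite eq_le leb_outer_translate_le/=.
have := leb_outer_translate_le [set x : 'rV[R]_m | A (x + v)%R] (- v).
by under eq_fun do rewrite /= subrK.
Qed.

(* [H] and its translate by [t e_i] differ by at most a slab of thickness [t], and [N] is in the
   difference for every [t]. *)
Lemma leb_outer_boundary_null (n : nat) (H N : set 'rV[R]_n.+1) (i : 'I_n.+1) :
  leb_measurable H ->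
  (forall x t, 0 < t -> H x -> H (x + t *: delta_mx 0 i)) ->
  (forall x, N x -> ~ H x) ->
  (forall x t, 0 < t -> N x -> H (x + t *: delta_mx 0 i)) ->
  leb_outer N = 0%E.
Proof.
move=> mH upH NH Nup.
pose B T : set 'rV[R]_n.+1 := box (const_mx (- T)) (const_mx T).
suff NB (T : nat) : leb_outer (N `&` B T%:R) = 0%E.
  apply: (leb_outer_subset_null _ (leb_outer_null_bigcup NB)) => x Nx.
  pose M := \sum_j `|x 0 j|.
  exists (Num.truncn M).+1 => //; split=> // j; rewrite !mxE -ler_norml.
  have : `|x 0 j| <= M.
    by rewrite /M (bigD1 j)//= lerDl sumr_ge0.
  move/le_trans; apply; apply/ltW.
  exact: truncnS_gt.
set K := T%:R.
have K0 : 0 <= K by exact: ler0n.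
have small (t : R) : 0 < t -> (leb_outer (N `&` B K) <= ((2 * K) ^+ n * t)%:E)%E.
  move=> t0; pose e : 'rV[R]_n.+1 := t *: delta_mx 0 i.
  pose slab : set 'rV[R]_n.+1 :=
    box (\row_j if j == i then K else - K) (\row_j if j == i then K + t else K).
  have slabvol : (leb_outer slab <= ((2 * K) ^+ n * t)%:E)%E.
    apply: le_trans (leb_outer_box _ _) _; rewrite lee_fin /box_vol (bigD1 i)//=.
    rewrite !mxE eqxx mulrC (eq_bigr (fun=> 2 * K)); last first.
      by move=> j /negbTE ji; rewrite !mxE ji max_l; lra.
    rewrite prodr_const cardC1 card_ord/= max_l; last by lra.
    by rewrite addrAC subrr add0r.
  have BK : (leb_outer (B K) < +oo)%E.
    by apply: le_lt_trans (leb_outer_box _ _) _; rewrite ltry.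
  have fin : leb_outer (H `&` B K) \is a fin_num.
    rewrite ge0_fin_numE ?leb_outer_ge0//; apply: le_lt_trans BK.
    by apply: le_leb_outer => x [].
  rewrite -(@leeD2lE R (leb_outer (H `&` B K)))//.
  apply: le_trans (leeD2l _ slabvol).
  (* [X] consists of the points of [B K] that [e] moves into [H]. It contains the parts of [H] and
     [N] in [B K], which are disjoint, while its translate by [e] lies in the union of [slab] and
     the part of [H] in [B K]. *)
  pose X := [set x : 'rV[R]_n.+1 | (H `&` [set y | B K (y - e)]) (x + e)].
  apply: (@le_trans _ _ (leb_outer X)).
    rewrite (mH X); apply: leeD; apply: le_leb_outer => x [].
      by move=> Hx Bx; split=> //; split; [exact: upH | rewrite /= addrK].
    move=> Nx Bx; split; last exact: NH.
    by split; [exact: Nup | rewrite /= addrK].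
  rewrite leb_outer_translate.
  apply: le_trans (outer_measureU2 (@leb_outer R n.+1) _ _).
  apply: le_leb_outer => x [Hx Bxe].
  have [Bx|nBx] := pselect (B K x); [by left | right].
  have other j : j != i -> - K <= x 0 j <= K.
    move=> ji; have := Bxe j.
    by rewrite !mxE eqxx (negbTE ji)/= mulr0 subr0.
  have xi : - K <= x 0 i - t <= K.
    by have := Bxe i; rewrite !mxE !eqxx mulr1.
  move=> j; rewrite !mxE; case: eqVneq => [->|/other//].
  apply/andP; split; last by move: xi => /andP[? ?]; lra.
  rewrite leNgt; apply/negP => xK; apply: nBx => l; rewrite !mxE.
  case: (eqVneq l i) => [->|/other//].
  by move: xi => /andP[? ?]; apply/andP; split; lra.
apply/eqP; rewrite eq_le leb_outer_ge0 andbT.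
apply/lee_addgt0Pr => e e0; rewrite add0e.
have c0 : 0 < (2 * K) ^+ n + 1.
  by rewrite ltr_wpDl// exprn_ge0// mulr_ge0.
apply: le_trans (small (e / ((2 * K) ^+ n + 1)) _) _; first by rewrite divr_gt0.
rewrite lee_fin mulrA ler_pdivrMr// mulrC ler_wpM2l ?ltW//.
by rewrite ltrDl.
Qed.

Lemma leb_outer_cylinder_null (k : nat) (A : set 'rV[R]_k.+1) (T : R) :
  leb_outer A = 0%E ->
  leb_outer [set pt p.1 p.2 | p in [set p | A p.1 /\ `|p.2| <= T]] = 0%E.
Proof.
move=> A0; have [T0|T0] := ltP T 0.
  apply: (leb_outer_subset_null _ (@leb_outer0 R _)) => y [p [Ap pT] yE].
  by have := normr_ge0 p.2; rewrite leNgt => /negP; apply; exact: le_lt_trans T0.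
apply/eqP; rewrite eq_le leb_outer_ge0 andbT.
apply/lee_addgt0Pr => e e0; rewrite add0e.
(* The [+ 1] keeps the denominator positive when [T = 0]. *)
have e'0 : 0 < e / (2 * T + 1) by rewrite divr_gt0//; lra.
have Afin : leb_outer A \is a fin_num by rewrite A0.
have [_ [a [b [Aab ->]]]] := lb_ereal_inf_adherent e'0 Afin.
rewrite -/(leb_outer A) A0 add0e => abe.
apply: (@le_trans _ _ (\sum_(0 <= j <oo) (2 * T)%:E * (box_vol (a j) (b j))%:E)%E).
  apply: ereal_inf_lbound.
  exists (fun j => row_mx (a j) (const_mx (- T))), (fun j => row_mx (b j) (const_mx T)).
  split=> [_ [p [Ap pT] <-]|].
    have [j _ jp] := Aab _ Ap; exists j => // i; rewrite /pt.
    case: (split_ordP i) => l ->; first by rewrite !row_mxEl.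
    by rewrite !row_mxEr !mxE -ler_norml.
  apply: eq_eseriesr => j _; rewrite -EFinM; congr (_%:E).
  rewrite /box_vol big_split_ord/= big_ord1 !row_mxEr !mxE mulrC.
  congr (_ * _); last by rewrite max_l; lra.
  by apply: eq_bigr => l _; rewrite !row_mxEl.
rewrite nneseriesZl; last by move=> *; rewrite lee_fin box_vol_ge0.
apply: (@le_trans _ _ ((2 * T)%:E * (e / (2 * T + 1))%:E)%E).
  by apply: lee_wpmul2l; [rewrite lee_fin; lra | exact: ltW].
rewrite -EFinM lee_fin mulrCA ler_piMr ?(ltW e0)//.
by rewrite ler_pdivrMr; lra.
Qed.

End BoxVolume.

(** * Cubes and their subdivision *)

Section Grid.
Variables (R : realType) (n : nat).

Definition cube (c : 'rV[R]_n) (l : R) : set 'rV[R]_n := box c (c + const_mx l).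

Definition subcube (c : 'rV[R]_n) (l : R) (N : nat) (q : {ffun 'I_n -> 'I_N}) :
    set 'rV[R]_n :=
  cube (c + \row_i ((q i)%:R * (l / N%:R))) (l / N%:R).

Lemma cube_vol (c : 'rV[R]_n) (l : R) : 0 <= l -> box_vol c (c + const_mx l) = l ^+ n.
Proof.
move=> l0; rewrite /box_vol (eq_bigr (fun=> l)) ?prodr_const ?card_ord// => i _.
by rewrite !mxE addrAC subrr add0r max_l.
Qed.

Lemma cube_cover (c : 'rV[R]_n) (l : R) (N : nat) (x : 'rV[R]_n) :
  0 <= l -> (0 < N)%N -> cube c l x -> exists q : {ffun 'I_n -> 'I_N}, subcube c l q x.
Proof.
move=> l0 N0 clx; pose s := l / N%:R.
have s0 : 0 <= s by rewrite divr_ge0.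
(* Induction instead of rounding down: the right end point must go to the last cell, and [s] may be
   0. *)
have step (m : nat) (y : R) : 0 <= y <= m.+1%:R * s ->
    exists2 q, (q < m.+1)%N & q%:R * s <= y <= q%:R * s + s.
  elim: m => [|m IH] /andP[y0 ym].
    by exists 0%N; rewrite // mul0r add0r y0 -[s]mul1r.
  have [ym'|ym'] := leP y (m.+1%:R * s).
    have [|q qm qy] := IH; first by rewrite y0.
    by exists q => //; exact: ltnW.
  exists m.+1 => //; rewrite (ltW ym')/=.
  by apply: le_trans ym _; rewrite [m.+2%:R]mulrSr mulrDl mul1r.
have /choice[q qx] : forall i, exists q : 'I_N,
    q%:R * s <= x 0 i - c 0 i <= q%:R * s + s.
  move=> i; have := clx i; rewrite !mxE => /andP[cx xc].
  have [|q qN qx] := step N.-1 (x 0 i - c 0 i).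
    rewrite prednK// subr_ge0 cx/= mulrC divfK ?pnatr_eq0 -?lt0n//.
    by rewrite lerBlDl.
  by rewrite prednK// in qN; exists (Ordinal qN).
exists (finfun q) => i; rewrite !mxE ffunE.
by have := qx i; rewrite -/s => /andP[? ?]; apply/andP; split; lra.
Qed.

End Grid.

(** * Distance to a set and near-minimizers *)

Section Euclid.
Variables (R : realType) (n : nat).
Implicit Types (u v w x y z : 'rV[R]_n).

Lemma edotxx_ge0 u : 0 <= edot u u.
Proof. by apply: sumr_ge0 => i _; rewrite -expr2 sqr_ge0. Qed.

Lemma enorm_ge0 u : 0 <= enorm u.
Proof. exact: sqrtr_ge0. Qed.

Lemma enorm_sqr u : enorm u ^+ 2 = edot u u.
Proof. by rewrite sqr_sqrtr ?edotxx_ge0. Qed.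

Lemma edotN u v : edot (- u) (- v) = edot u v.
Proof. by apply: eq_bigr => i _; rewrite !mxE mulrNN. Qed.

Lemma enormB u v : enorm (u - v) = enorm (v - u).
Proof. by rewrite /enorm -edotN !opprB. Qed.

Lemma edotBB u v : edot (u - v) (u - v) = edot u u - 2 * edot u v + edot v v.
Proof.
rewrite /edot mulr_sumr -sumrB -big_split/=.
by apply: eq_bigr => i _; rewrite !mxE; ring.
Qed.

Lemma coord_sqr_le_edot u i : u 0 i ^+ 2 <= edot u u.
Proof.
rewrite /edot (bigD1 i)//= -expr2 lerDl.
by apply: sumr_ge0 => j _; rewrite -expr2 sqr_ge0.
Qed.

Lemma coord_le_enorm u i : `|u 0 i| <= enorm u.
Proof.
rewrite -(ler_pXn2r (ltn0Sn 1)) ?nnegrE ?enorm_ge0//.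
by rewrite real_normK ?num_real// enorm_sqr coord_sqr_le_edot.
Qed.

Lemma cauchy_schwarz u v : edot u v ^+ 2 <= edot u u * edot v v.
Proof.
have [v0|v0] := ltP 0 (edot v v); last first.
  have v00 i : v 0 i = 0.
    apply/eqP; rewrite -sqrf_eq0 eq_le sqr_ge0 andbT.
    exact: le_trans (coord_sqr_le_edot v i) v0.
  rewrite [edot u v]big1 ?expr0n/= ?mulr_ge0 ?edotxx_ge0// => i _.
  by rewrite v00 mulr0.
have := edotxx_ge0 (edot v v *: u - edot u v *: v).
have edotZ a b (p q : 'rV[R]_n) : edot (a *: p) (b *: q) = a * b * edot p q.
  by rewrite /edot mulr_sumr; apply: eq_bigr => i _; rewrite !mxE; ring.
rewrite edotBB !edotZ => h.
have : 0 <= edot v v * (edot u u * edot v v - edot u v ^+ 2) by move: h; lra.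
by rewrite pmulr_rge0// subr_ge0.
Qed.

Lemma norm_edot_le u v : `|edot u v| <= enorm u * enorm v.
Proof.
rewrite -(ler_pXn2r (ltn0Sn 1)) ?nnegrE ?mulr_ge0 ?enorm_ge0//.
by rewrite real_normK ?num_real// exprMn !enorm_sqr cauchy_schwarz.
Qed.

Lemma enorm_triangle x y z : enorm (x - z) <= enorm (x - y) + enorm (y - z).
Proof.
rewrite -(ler_pXn2r (ltn0Sn 1)) ?nnegrE ?addr_ge0 ?enorm_ge0//.
rewrite sqrrD !enorm_sqr.
have -> : x - z = (x - y) - (z - y) by rewrite opprB addrA subrK.
rewrite edotBB -(edotN (z - y)) opprB (enormB y).
have := norm_edot_le (x - y) (z - y); rewrite ler_norml => /andP[? _].
by rewrite mulr2n; lra.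
Qed.

Lemma enorm_le_coord u (M : R) : 0 <= M -> (forall i, `|u 0 i| <= M) ->
  enorm u <= n%:R * M.
Proof.
move=> M0 uM; have [n0|n_gt0] := posnP n.
  rewrite /enorm /edot big1 ?sqrtr0 ?mulr_ge0// => i _.
  by have := ltn_ord i; rewrite [X in (_ < X)%N]n0.
rewrite -(ler_pXn2r (ltn0Sn 1)) ?nnegrE ?mulr_ge0 ?enorm_ge0//.
rewrite enorm_sqr exprMn.
apply: (@le_trans _ _ (\sum_(i < n) M ^+ 2)).
  apply: ler_sum => i _; rewrite -expr2 -real_normK ?num_real//.
  by rewrite ler_pXn2r// nnegrE.
rewrite sumr_const card_ord -[leLHS]mulr_natl; apply: ler_wpM2r; first exact: sqr_ge0.
by rewrite expr2 ler_peMl// ler1n.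
Qed.

End Euclid.

Section Distance.
Variables (R : realType) (n : nat) (K : set 'rV[R]_n).
Implicit Types x y z : 'rV[R]_n.

(** For empty [K], [fine] turns [+oo] into 0, so the Lipschitz bound below holds for every [K]. *)
Definition dist_to x : R := fine (edist_set x K).

Lemma edist_set_ge0 x : (0 <= edist_set x K)%E.
Proof. by apply: le_ereal_inf_tmp => _ [z _ <-]; rewrite lee_fin enorm_ge0. Qed.

Lemma edist_setE x z : K z -> edist_set x K = (dist_to x)%:E.
Proof.
move=> Kz; rewrite /dist_to fineK// ge0_fin_numE ?edist_set_ge0//.
by apply: le_lt_trans (ltry (enorm (x - z))); apply: ereal_inf_lbound; exists z.
Qed.

Lemma dist_to_ge0 x : 0 <= dist_to x.
Proof. exact/fine_ge0/edist_set_ge0. Qed.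

Lemma dist_to_le x z : K z -> dist_to x <= enorm (x - z).
Proof.
move=> Kz; rewrite -lee_fin -(edist_setE x Kz).
by apply: ereal_inf_lbound; exists z.
Qed.

Lemma dist_to_lip x y : dist_to x <= dist_to y + enorm (x - y).
Proof.
have [[z Kz]|/nonemptyPn K0] := pselect (K !=set0); last first.
  have d0 p : dist_to p = 0 by rewrite /dist_to /edist_set K0 image_set0 ereal_inf0.
  by rewrite !d0 add0r enorm_ge0.
rewrite -lerBlDr -lee_fin -(edist_setE y Kz).
apply: le_ereal_inf_tmp => _ [w Kw <-]; rewrite lee_fin lerBlDr addrC.
exact: le_trans (dist_to_le x Kw) (enorm_triangle _ _ _).
Qed.

(** As [r <= f x], every [w] in [K] satisfies [|x - z|^2 <= (f x + r)^2 <= |x - w|^2 + 3 f(x) r].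
    Take [w = z'], add the same bound at [x'] with [w = z], and expand the squares. *)
Lemma near_monotone x x' z z' r :
  K z -> K z' -> 0 <= r -> r <= dist_to x -> r <= dist_to x' ->
  enorm (x - z) <= dist_to x + r -> enorm (x' - z') <= dist_to x' + r ->
  - (3 / 2 * (dist_to x + dist_to x') * r) <= edot (x' - x) (z' - z).
Proof.
move=> Kz Kz' r0 rx rx' xz xz'.
have sq p q w : K w -> 0 <= dist_to p -> r <= dist_to p ->
    enorm (p - q) <= dist_to p + r ->
    edot (p - q) (p - q) <= edot (p - w) (p - w) + 3 * dist_to p * r.
  move=> Kw p0 rp pq; rewrite -!enorm_sqr.
  have h1 : enorm (p - q) ^+ 2 <= (dist_to p + r) ^+ 2.
    by rewrite ler_pXn2r ?nnegrE ?enorm_ge0// addr_ge0.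
  have h2 : dist_to p ^+ 2 <= enorm (p - w) ^+ 2.
    by rewrite ler_pXn2r ?nnegrE ?enorm_ge0// dist_to_le.
  have h3 : r * r <= dist_to p * r by rewrite ler_wpM2r.
  by move: h1 h2 h3; rewrite sqrrD !expr2; lra.
have h1 := sq x z z' Kz' (dist_to_ge0 x) rx xz.
have h2 := sq x' z' z Kz (dist_to_ge0 x') rx' xz'.
have : 2 * edot (x' - x) (z' - z) =
    edot (x - z') (x - z') + edot (x' - z) (x' - z) -
    edot (x - z) (x - z) - edot (x' - z') (x' - z').
  rewrite /edot mulr_sumr -big_split/= -!sumrB.
  by apply: eq_bigr => i _; rewrite !mxE; ring.
by move: h1 h2; lra.
Qed.

(* What is used of [setG]: the angle condition only enters through the distance of [z1] and [z2]. *)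
Definition spread (delta r : R) : set 'rV[R]_n := [set x |
  [/\ 0 < r, r < dist_to x & exists z1 z2, [/\ K z1, K z2,
    enorm (x - z1) <= dist_to x + r, enorm (x - z2) <= dist_to x + r &
    8 * delta * dist_to x ^+ 2 <= edot (z1 - z2) (z1 - z2)]]].

End Distance.

(** * From the angle condition to separated near-minimizers *)

Section Angle.
Variables (R : realType) (n : nat).
Implicit Types (x z : 'rV[R]_n).

(** The cosine decreases on [[0, pi]], and Cauchy-Schwarz puts the quotient in the domain of
    [acos]. *)
Lemma seg_angle_gt (c : R) x z1 z2 : -1 <= c <= 1 ->
  0 < enorm (x - z1) -> 0 < enorm (x - z2) ->
  (acos c < `|seg_angle x z1 z2|) =
  (edot (z1 - x) (z2 - x) < c * (enorm (x - z1) * enorm (x - z2))).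
Proof.
move=> c1 a0 b0; rewrite /seg_angle (enormB z1) (enormB z2).
set t := _ / _.
have ab0 : 0 < enorm (x - z1) * enorm (x - z2) by rewrite mulr_gt0.
have t1 : -1 <= t <= 1.
  rewrite -ler_norml normrM normfV (gtr0_norm ab0) ler_pdivrMr// mul1r.
  by rewrite (enormB x) (enormB x) norm_edot_le.
rewrite ger0_norm ?acos_ge0// -ltr_cos ?in_itv/= ?acos_ge0 ?acos_lepi//.
by rewrite !acosK ?in_itv//= ltr_pdivrMr.
Qed.

Lemma angle_bound_itv (delta eps : R) :
  0 < delta -> 0 <= eps -> 2 * delta + eps < 1 ->
  -1 <= 2 * ((1 - (2 * delta + eps)) / (1 + 2 * delta)) ^+ 2 - 1 <= 1 - 4 * delta.
Proof.
move=> delta0 eps0 de.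
have [d1 d2] : 0 <= 1 - (2 * delta + eps) /\ 0 < 1 + 2 * delta by split; lra.
pose q : R := (1 - (2 * delta + eps)) / (1 + 2 * delta).
have q0 : 0 <= q by apply: divr_ge0 => //; exact: ltW.
(* [(1 - 2 delta)(1 + 2 delta) >= 1 - 2 delta] because [2 delta <= 1]. Together with [q^2 <= q] this
   gives [2 q^2 - 1 <= 1 - 4 delta]. *)
have q1 : q <= 1 - 2 * delta.
  rewrite /q ler_pdivrMr//.
  have : 0 <= delta * (1 - 2 * delta) by apply: mulr_ge0; lra.
  by lra.
have q2 : q * q <= q by rewrite ler_piMl//; lra.
have := mulr_ge0 q0 q0; rewrite -/q.
by rewrite expr2 => ?; apply/andP; split; lra.
Qed.

(** Law of cosines: if the sides are [a], [b >= f] and the cosine is below [1 - 4 delta], then [|z1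
    - z2|^2 >= (a - b)^2 + 8 delta a b >= 8 delta f^2]. *)
Lemma setG_spread (K : set 'rV[R]_n) (delta eps : R) x r :
  0 < delta -> 0 <= eps -> 2 * delta + eps < 1 ->
  setG K eps delta (x, r) -> spread K delta r x.
Proof.
move=> delta0 eps0 de [/= r0 rx [z1 [z2 [Kz1 Kz2]]]].
move: rx; rewrite (edist_setE x Kz1) -EFinD !lee_fin lte_fin => rx xz1 xz2.
have d1 := dist_to_le x Kz1; have d2 := dist_to_le x Kz2.
set q : R := 2 * _ ^+ 2 - 1.
have : -1 <= q <= 1 - 4 * delta := angle_bound_itv delta0 eps0 de.
move: q => q /andP[q1 q2].
rewrite seg_angle_gt; [|by apply/andP; split; lra|lra|lra].
move=> ang; split=> //; exists z1, z2; have er : eps * r <= r.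
  by rewrite ler_piMl ?ltW//; lra.
split=> //; try by lra.
have -> : z1 - z2 = (z1 - x) - (z2 - x) by rewrite opprB addrA subrK.
rewrite edotBB -!enorm_sqr (enormB z1) (enormB z2).
move: ang d1 d2; set a := enorm (x - z1); set b := enorm (x - z2); set f := dist_to K x.
move=> ang d1 d2.
have f0 : 0 < f := lt_trans r0 rx.
have h1 : q * (a * b) <= (1 - 4 * delta) * (a * b).
  by rewrite ler_wpM2r// mulr_ge0//; lra.
have h2 : delta * (f * f) <= delta * (a * b).
  by apply: ler_wpM2l; [lra | apply: ler_pM; lra].
have := sqr_ge0 (a - b).
by move: ang h1 h2; rewrite sqrrB !expr2; lra.
Qed.

End Angle.

(** * The grid count *)

Lemma eq_modn_close (M a b : nat) :
  a = b %[mod M.+1] -> (a <= b + M)%N -> (b <= a + M)%N -> a = b.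
Proof.
wlog ab : a b / (a <= b)%N => [W|] mE h1 h2.
  by have [/W|/ltnW/W H] := leqP a b; [apply | apply/esym/H].
move: mE => /eqP; rewrite eq_sym eqn_mod_dvd// => /dvdnP[[|m] dm].
  by apply/eqP; rewrite eqn_leq ab -subn_eq0 dm.
have : (M.+1 <= b - a)%N by rewrite dm mulSn leq_addr.
by rewrite leq_subRL// addnS ltnNge h2.
Qed.

(* [q] is determined by its direction, its coordinates off that direction, [v q], and the residue mod
   [M.+1] of the remaining coordinate. *)
Lemma sparse_grid_card (n N M : nat) (bad : {pred {ffun 'I_n.+1 -> 'I_N}})
    (dir : {ffun 'I_n.+1 -> 'I_N} -> 'I_n.+1) (v : {ffun 'I_n.+1 -> 'I_N} -> nat) :
  (forall q, q \in bad -> (v q <= M)%N) ->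
  (forall q q', q \in bad -> q' \in bad -> dir q = dir q' ->
     (forall j, j != dir q -> q j = q' j) -> v q = v q' ->
     (q' (dir q) <= q (dir q) + M)%N) ->
  (#|bad| <= n.+1 * N ^ n * M.+1 ^ 2)%N.
Proof.
move=> vM sparse.
pose code (q : {ffun 'I_n.+1 -> 'I_N}) :
    'I_n.+1 * {ffun 'I_n -> 'I_N} * 'I_M.+1 * 'I_M.+1 :=
  (dir q, [ffun j => q (lift (dir q) j)], inord (v q), inord (q (dir q) %% M.+1)).
have code_inj : {in bad &, injective code}.
  move=> q q' qb qb' [dE /ffunP oE /(congr1 val)/= vE /(congr1 val)/= mE].
  have off j : j != dir q -> q j = q' j.
    rewrite eq_sym => /unlift_some[l -> _].
    by have := oE l; rewrite !ffunE -dE.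
  have off' j : j != dir q' -> q' j = q j by rewrite -dE => /off.
  have {}vE : v q = v q' by rewrite !inordK ?ltnS ?vM// in vE.
  have {}mE : q (dir q) = q' (dir q) %[mod M.+1].
    by move: mE; rewrite !inordK ?ltn_mod// -dE.
  have h1 := sparse _ _ qb qb' dE off vE.
  have := sparse _ _ qb' qb (esym dE) off' (esym vE); rewrite -dE => h2.
  apply/ffunP => j; have [->|/off//] := eqVneq j (dir q).
  apply/val_inj => /=.
  exact: eq_modn_close mE h2 h1.
rewrite -(card_in_imset code_inj); apply: leq_trans (max_card _) _.
by rewrite !card_prod card_ffun !card_ord -mulnA mulnn.
Qed.

Section Sparse.
Variables (R : realType) (n : nat) (K : set 'rV[R]_n.+1) (delta : R).
Hypotheses (delta0 : 0 < delta) (delta1 : 2 * delta < 1).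

Let k : R := n.+1%:R.
Let k1 : 1 <= k. Proof. by rewrite ler1n. Qed.

(* Two near-minimizers at a point of [spread K delta r] differ by at least [sep * f] in some coordinate;
   [gap] is large enough for the monotonicity error over [gap] mesh steps to be at most [sep * f / 2]. *)
Definition sep : R := 4 * delta / k.
Definition gap : nat := (Num.truncn ((24 + 18 * k) / sep)).+1.

Lemma sep_gt0 : 0 < sep.
Proof. by rewrite divr_gt0// ?mulr_gt0//; lra. Qed.

Lemma gapP : 24 + 18 * k < gap%:R * sep.
Proof. by rewrite -ltr_pdivrMr ?sep_gt0// truncnS_gt. Qed.

(** If every coordinate differed by less than [sep * D], then [|z1 - z2|^2 <= k (sep D)^2 = 16
    delta^2 D^2 / k < 8 delta f^2], since [2 delta < 1]. Swapping the pair fixes the sign. *)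
Lemma spread_coord (D r : R) x : 0 <= D -> D <= dist_to K x -> spread K delta r x ->
  exists (i : 'I_n.+1) z1 z2, [/\ K z1, K z2,
    enorm (x - z1) <= dist_to K x + r, enorm (x - z2) <= dist_to K x + r &
    sep * D <= z1 0 i - z2 0 i].
Proof.
move=> D0 Df [r0 rx [z1 [z2 [Kz1 Kz2 xz1 xz2 z12]]]].
have [i zi] : exists i, sep * D <= `|z1 0 i - z2 0 i|.
  apply: contrapT => /forallNP small.
  have sD0 : 0 <= sep * D by apply: mulr_ge0 => //; exact/ltW/sep_gt0.
  have : edot (z1 - z2) (z1 - z2) <= k * (sep * D) ^+ 2.
    rewrite mulr_natl -[n.+1 in leRHS]card_ord -sumr_const.
    apply: ler_sum => i _; rewrite -expr2 -real_normK ?num_real//.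
    rewrite ler_pXn2r ?nnegrE//.
    by have /negP := small i; rewrite -ltNge !mxE => /ltW.
  have k0 : 0 < k by exact: lt_le_trans k1.
  rewrite (_ : k * (sep * D) ^+ 2 = 16 * delta ^+ 2 * D ^+ 2 / k); last first.
    by rewrite /sep; field; rewrite lt0r_neq0.
  have f0 : 0 < dist_to K x ^+ 2 by rewrite exprn_gt0//; lra.
  have Dsq : D ^+ 2 <= dist_to K x ^+ 2.
    by rewrite ler_pXn2r// nnegrE//; lra.
  apply/negP; rewrite -ltNge; apply: lt_le_trans z12.
  apply: (@le_lt_trans _ _ (16 * delta ^+ 2 * dist_to K x ^+ 2)).
    rewrite ler_pdivrMr// -[leLHS]mulr1; apply: ler_pM => //.
      by rewrite !mulr_ge0 ?sqr_ge0// ltW.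
    by apply: ler_wpM2l => //; rewrite mulr_ge0// sqr_ge0.
  rewrite ltr_pM2r// expr2.
  have : 0 < delta * (1 - 2 * delta) by rewrite mulr_gt0// subr_gt0.
  by lra.
have [z0|z0] := leP 0 (z1 0 i - z2 0 i).
  by exists i, z1, z2; split=> //; rewrite ger0_norm in zi.
by exists i, z2, z1; split=> //; rewrite ltr0_norm// opprB in zi.
Qed.

(** An application of [sparse_grid_card]: the direction is a coordinate separating the two
    near-minimizers, and [v] is the position of the lower one along it, in units of
    [sep * D / 2]. *)
Lemma spread_grid_count (c : 'rV[R]_n.+1) (l D r : R) (N : nat) :
  0 < l -> 0 < r -> (0 < N)%N -> r <= 2 * (l / N%:R) -> l <= D ->
  (forall x, cube c l x -> D <= dist_to K x <= 2 * D) ->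
  (#|[pred q : {ffun 'I_n.+1 -> 'I_N} |
      `[< exists x, [/\ spread K delta r x, cube c l x & subcube c l q x] >]]|
    <= n.+1 * N ^ n * gap.+1 ^ 2)%N.
Proof.
move=> l0 r0 N0; set s := l / N%:R => rs lD fD.
have D0 : 0 < D by exact: lt_le_trans lD.
have s0 : 0 < s by rewrite divr_gt0// ltr0n.
have B0 := sep_gt0.
set bad := [pred q | _].
pose data := ('rV[R]_n.+1 * 'rV[R]_n.+1 * 'rV[R]_n.+1 * 'I_n.+1)%type.
(* For a bad cell, [d q] holds a point, its upper and its lower near-minimizer, and the coordinate
   separating them. *)
have [d dP] : {d : {ffun 'I_n.+1 -> 'I_N} -> data & forall q, q \in bad ->
    [/\ r < dist_to K (d q).1.1.1, cube c l (d q).1.1.1, subcube c l q (d q).1.1.1 &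
     [/\ K (d q).1.1.2, K (d q).1.2,
      enorm ((d q).1.1.1 - (d q).1.1.2) <= dist_to K (d q).1.1.1 + r,
      enorm ((d q).1.1.1 - (d q).1.2) <= dist_to K (d q).1.1.1 + r &
      sep * D <= (d q).1.1.2 0 (d q).2 - (d q).1.2 0 (d q).2]]}.
  apply: (@choice _ _ (fun q (e : data) => q \in bad ->
    [/\ r < dist_to K e.1.1.1, cube c l e.1.1.1, subcube c l q e.1.1.1 &
     [/\ K e.1.1.2, K e.1.2, enorm (e.1.1.1 - e.1.1.2) <= dist_to K e.1.1.1 + r,
      enorm (e.1.1.1 - e.1.2) <= dist_to K e.1.1.1 + r &
      sep * D <= e.1.1.2 0 e.2 - e.1.2 0 e.2]])) => q.
  have [qb|qb] := boolP (q \in bad); last by exists (0, 0, 0, ord0).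
  have [x [Ax xc xq]] := asboolW qb.
  have /andP[Dx _] := fD x xc.
  have [i [z1 [z2 [? ? ? ? ?]]]] := spread_coord (ltW D0) Dx Ax.
  by exists (x, z1, z2, i) => _; split=> //; case: Ax.
pose X q := (d q).1.1.1; pose Z1 q := (d q).1.1.2; pose Z2 q := (d q).1.2.
pose I q := (d q).2.
have XZ q j : q \in bad -> `|X q 0 j - Z1 q 0 j| <= 4 * D /\ `|X q 0 j - Z2 q 0 j| <= 4 * D.
  move=> /dP[rX Xc _ [_ _ XZ1 XZ2 _]]; have /andP[_ X2] := fD _ Xc.
  have := coord_le_enorm (X q - Z1 q) j; have := coord_le_enorm (X q - Z2 q) j.
  rewrite !mxE; move: XZ1 XZ2 rX X2; rewrite -/(X q) -/(Z1 q) -/(Z2 q).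
  by move=> *; split; lra.
have Xc q j : q \in bad -> 0 <= X q 0 j - c 0 j <= l.
  move=> /dP[_ Xc _ _]; have := Xc j; rewrite !mxE -/(X q) => /andP[? ?].
  by apply/andP; split; lra.
(* The lower near-minimizer is within [f + r <= 4 D] of a point of the cube, and [l <= D], so its
   coordinate ranges over [[c - 4 D, c + 5 D]] and [0 <= u <= 18 / sep <= gap]. *)
pose u q := (Z2 q 0 (I q) - (c 0 (I q) - 4 * D)) / (sep * D / 2).
have BD0 : 0 < sep * D / 2 by apply: divr_gt0 => //; exact: mulr_gt0.
have u0 q : q \in bad -> 0 <= u q.
  move=> qb; apply: divr_ge0; last exact: ltW.
  have := Xc q (I q) qb; have [_] := XZ q (I q) qb.
  by rewrite ler_norml => /andP[? ?] /andP[? ?]; lra.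
have gB : 24 * D + 18 * (k * D) < gap%:R * (sep * D).
  by have := gapP; rewrite -(ltr_pM2r D0); lra.
have kD0 : 0 <= k * D by rewrite mulr_ge0 ?ltW//; lra.
apply: (@sparse_grid_card n N gap bad I (fun q => Num.truncn (u q))) => [q qb|].
  rewrite -(ler_nat R); apply: (@le_trans _ _ (u q)).
    by have /andP[] := truncn_itv (u0 q qb).
  rewrite ler_pdivrMr//.
  have := Xc q (I q) qb; have [_] := XZ q (I q) qb.
  by rewrite ler_norml => /andP[? ?] /andP[? ?]; lra.
move=> q q' qb qb' dE off vE; rewrite leqNgt; apply/negP => far.
set i := I q.
have cubeq p j : p \in bad -> (p j)%:R * s <= X p 0 j - c 0 j <= (p j)%:R * s + s.
  move=> /dP[_ _ Xp _]; have := Xp j; rewrite !mxE -/(X p) -/s => /andP[? ?].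
  by apply/andP; split; lra.
have Xi : gap%:R * s <= X q' 0 i - X q 0 i.
  have /andP[_ h1] := cubeq q i qb; have /andP[h2 _] := cubeq q' i qb'.
  have : (q i + gap.+1)%:R * s <= (q' i)%:R * s.
    by rewrite ler_pM2r// ler_nat addnS.
  by rewrite natrD mulrDl -[gap.+1]addn1 natrD mulrDl mul1r; lra.
have Xj j : j != i -> `|X q' 0 j - X q 0 j| <= s.
  move=> /off qj; have := cubeq q j qb; have := cubeq q' j qb'.
  rewrite qj => /andP[? ?] /andP[? ?].
  by rewrite ler_norml; apply/andP; split; lra.
have Zj j : `|Z2 q' 0 j - Z1 q 0 j| <= 9 * D.
  have [_] := XZ q' j qb'; have [+ _] := XZ q j qb.
  have := Xc q j qb; have := Xc q' j qb'.
  move=> /andP[? ?] /andP[? ?]; rewrite !ler_norml => /andP[? ?] /andP[? ?].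
  by apply/andP; split; lra.
(* The error [3/2 (f + f') r] is at most [6 D r <= 12 D s]. *)
have mono : - (12 * D * s) <= edot (X q' - X q) (Z2 q' - Z1 q).
  have [rq qc _ [Kz1 _ xz1 _ _]] := dP q qb.
  have [rq' qc' _ [_ Kz2 _ xz2 _]] := dP q' qb'.
  apply: le_trans (near_monotone Kz1 Kz2 (ltW r0) (ltW rq) (ltW rq') xz1 xz2).
  rewrite lerN2; have /andP[_ f1] := fD _ qc; have /andP[_ f2] := fD _ qc'.
  apply: (@le_trans _ _ (6 * D * r)); last first.
    rewrite (_ : 12 * D * s = 6 * D * (2 * s)); last by ring.
    by apply: ler_wpM2l => //; lra.
  by apply: ler_wpM2r; [exact: ltW | lra].
have upper : edot (X q' - X q) (Z2 q' - Z1 q) <=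
    (X q' 0 i - X q 0 i) * (Z2 q' 0 i - Z1 q 0 i) + k * (s * (9 * D)).
  rewrite /edot (bigD1 i)//= !mxE lerD2l.
  apply: (@le_trans _ _ (\sum_(j < n.+1 | j != i) s * (9 * D))).
    apply: ler_sum => j ji; rewrite !mxE.
    apply: le_trans (ler_norm _) _; rewrite normrM.
    by apply: ler_pM => //; exact: Xj.
  rewrite sumr_const -[leLHS]mulr_natl; apply: ler_wpM2r.
    by apply: mulr_ge0; [exact: ltW | lra].
  by rewrite ler_nat cardC1 card_ord.
have [_ _ _ [_ _ _ _ zsep]] := dP q qb.
(* A drop by more than [sep * D / 2] over a distance of at least [gap * s] would push the product
   below [- (12 + 9 k) D s] by [gapP], against [mono] and [upper]. *)
have far_w : - (sep * D / 2) <= Z2 q' 0 i - Z1 q 0 i.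
  rewrite leNgt; apply/negP => w.
  have g0 : 0 < gap%:R * s by rewrite mulr_gt0// ltr0n.
  have h1 : (X q' 0 i - X q 0 i) * (Z2 q' 0 i - Z1 q 0 i) <=
      (gap%:R * s) * (- (sep * D / 2)).
    apply: (@le_trans _ _ ((X q' 0 i - X q 0 i) * (- (sep * D / 2)))).
      by apply: ler_wpM2l; lra.
    by rewrite !mulrN lerN2; apply: ler_wpM2r => //; exact: ltW.
  have : 0 < s * (gap%:R * (sep * D) - (24 * D + 18 * (k * D))).
    by rewrite mulr_gt0// subr_gt0.
  by move: h1 mono upper; lra.
(* From [Z2 q] to [Z1 q] the coordinate gains [sep * D], and from there to [Z2 q'] it loses at most
   half of that; so [u] gains a unit and its integer part changes. *)
have : u q + 1 <= u q'.
  rewrite /u -dE -/i -[X in _ + X](divff (lt0r_neq0 BD0)) -mulrDl ler_pM2r ?invr_gt0//.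
  by move: zsep far_w; rewrite -/(Z1 q) -/(Z2 q) -/(I q) -/i; lra.
have /andP[+ _] := truncn_itv (u0 q qb); have /andP[_] := truncn_itv (u0 q' qb').
by rewrite -vE -natr1; lra.
Qed.

Definition density : R := n.+1%:R * (gap.+1%:R) ^+ 2.

Lemma density_ge1 : 1 <= density.
Proof.
by rewrite /density -natrX -natrM ler1n muln_gt0 expn_gt0.
Qed.

(** The factor 3 keeps [f] between [D = f(c) - k l] and [D + 2 k l <= 2 D] on the cube. Then at most
    [density * N ^ n] cells of side [l / N] meet the set. *)
Lemma spread_outer_le (c : 'rV[R]_n.+1) (l r : R) :
  0 < l -> 0 < r -> 3 * k * l <= dist_to K c ->
  (leb_outer (spread K delta r `&` cube c l) <=
    (density * (r / l) * l ^+ n.+1)%:E)%E.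
Proof.
move=> l0 r0 fc.
have ln0 : 0 < l ^+ n.+1 by rewrite exprn_gt0.
have [lr|rl] := leP l r.
  apply: (@le_trans _ _ (l ^+ n.+1)%:E).
    rewrite -(cube_vol c (ltW l0)); apply: le_trans (leb_outer_box _ _).
    by apply: le_leb_outer => x [].
  rewrite lee_fin ler_peMl ?(ltW ln0)//.
  rewrite -[1]mulr1; apply: ler_pM => //; first exact: density_ge1.
  by rewrite ler_pdivlMr// mul1r.
(* [l / r < N <= 2 l / r], so the mesh [l / N] lies between [r / 2] and [r]. *)
pose N := (Num.truncn (l / r)).+1.
have lr0 : 0 <= l / r by rewrite divr_ge0 ?ltW.
have lN : l / r < N%:R by exact: truncnS_gt.
have Nl : N%:R <= 2 * (l / r).
  have /andP[h _] := truncn_itv lr0.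
  have : 1 <= l / r by rewrite ler_pdivlMr// mul1r ltW.
  by rewrite /N -natr1; lra.
have N0 : 0 < N%:R :> R by rewrite ltr0n.
have rs : r <= 2 * (l / N%:R).
  rewrite mulrA ler_pdivlMr// mulrC -ler_pdivlMr//.
  by rewrite -mulrA.
pose D := dist_to K c - k * l.
have kl : l <= k * l by rewrite ler_peMl// ltW.
have lD : l <= D by rewrite /D; lra.
have fD x : cube c l x -> D <= dist_to K x <= 2 * D.
  move=> xc; have xcl : enorm (x - c) <= k * l.
    apply: enorm_le_coord => [|i]; first exact: ltW.
    have := xc i; rewrite !mxE => /andP[? ?].
    by rewrite ler_norml; apply/andP; split; lra.
  have := dist_to_lip K x c; have := dist_to_lip K c x; rewrite (enormB c).
  by move=> *; rewrite /D; apply/andP; split; lra.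
have := spread_grid_count l0 r0 (ltn0Sn _ : (0 < N)%N) rs lD fD.
set bad := [pred q | _]; move=> badN.
apply: (@le_trans _ _ (\sum_(q in bad) leb_outer (subcube c l q))%E).
  apply: leb_outer_fin_cover => x [Ax xc].
  have [q xq] := cube_cover (ltW l0) (ltn0Sn _ : (0 < N)%N) xc.
  exists q; last exact: xq.
  by apply: asboolT; exists x.
apply: (@le_trans _ _ (\sum_(q in bad) ((l / N%:R) ^+ n.+1)%:E)%E).
  apply: lee_sum => q _; rewrite -(cube_vol (c + \row_i ((q i)%:R * (l / N%:R)))).
    exact: leb_outer_box.
  by rewrite divr_ge0 ?ltW.
rewrite sumEFin lee_fin sumr_const -[leLHS]mulr_natl.
apply: (@le_trans _ _ ((n.+1 * N ^ n * gap.+1 ^ 2)%:R * (l / N%:R) ^+ n.+1)).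
  by rewrite ler_pM2r ?ler_nat// exprn_gt0// divr_gt0.
have -> : (n.+1 * N ^ n * gap.+1 ^ 2)%:R * (l / N%:R) ^+ n.+1 =
    density * N%:R^-1 * l ^+ n.+1.
  rewrite /density !natrM !natrX expr_div_n exprSr [N%:R ^+ n.+1]exprSr.
  by field; rewrite ?expf_neq0 ?lt0r_neq0.
apply: ler_wpM2r; first exact: ltW.
apply: ler_wpM2l; first by have := density_ge1; lra.
by rewrite -[r / l]invf_div lef_pV2 ?posrE ?divr_gt0// ltW.
Qed.

End Sparse.

(** * Dyadic descent and the Carleson integral *)

Section DyadicScales.
Variables (R : realType) (n : nat).

(** A supremum over a dyadic shell, whose [dr/r]-mass is at most 1; it is subadditive when [Q] is
    cut into subcubes. *)
Definition scale_sup (A : R -> set 'rV[R]_n) (rho : R) (Q : set 'rV[R]_n) : \bar R :=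
  ereal_sup [set leb_outer (A r `&` Q) | r in [set r | rho / 2 < r <= rho]].

(* [Num.min] carries the induction: the terms from the first admissible one on form a geometric series. *)
Lemma dyadic_sum_le (p : nat) (rho X : R) : 0 < rho -> 0 < X ->
  \sum_(m < p) (if rho / 2 ^+ m < X then rho / 2 ^+ m else 0) <= 2 * Num.min rho X.
Proof.
elim: p rho => [|p IH] rho rho0 X0.
  by rewrite big_ord0 mulr_ge0// le_min !ltW.
rewrite big_ord_recl expr0 divr1.
have h0 : 0 < rho / 2 by rewrite divr_gt0.
have := IH _ h0 X0.
under eq_bigr => m _ do rewrite -mulrA -invfM -exprS.
set S := \sum_(m < p) _; rewrite minEle; case: ifPn => [le1|]; rewrite ?minEle.
  by move=> h1; have [h|h] := ltP rho X; have [h'|h'] := leP rho X; lra.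
by rewrite -ltNge => h1 h2; have [h|h] := ltP rho X; have [h'|h'] := leP rho X; lra.
Qed.

Lemma dyadic_shell (rho r : R) : 0 < r -> r <= rho ->
  exists m, rho / 2 ^+ m / 2 < r <= rho / 2 ^+ m.
Proof.
move=> r0 rrho.
have ex : exists m, rho / 2 ^+ m.+1 < r.
  exists (Num.truncn (rho / r)).+1; rewrite ltr_pdivrMr ?exprn_gt0// mulrC -ltr_pdivrMr//.
  apply: lt_trans (truncnS_gt _) _.
  rewrite -natrX ltr_nat; apply: ltn_trans (ltn_expl _ _) => //.
case: (ex_minnP ex) => m rm min; exists m; apply/andP; split.
  by rewrite -mulrA -invfM -exprSr.
case: m rm min => [|m] _ min; first by rewrite expr0 divr1.
by rewrite leNgt; apply/negP => /min; rewrite ltnn.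
Qed.

End DyadicScales.

Lemma subcube_sub (R : realType) (n N : nat) (c : 'rV[R]_n) (l : R)
    (q : {ffun 'I_n -> 'I_N}) :
  0 <= l -> subcube c l q `<=` cube c l.
Proof.
move=> l0 x xq i; have := xq i; rewrite !mxE.
have N0 : (0 < N)%N by apply: leq_ltn_trans (ltn_ord (q i)).
have s0 : 0 <= l / N%:R by rewrite divr_ge0.
have qs : 0 <= (q i)%:R * (l / N%:R) by rewrite mulr_ge0.
have : (q i).+1%:R * (l / N%:R) <= N%:R * (l / N%:R) by rewrite ler_wpM2r// ler_nat.
rewrite [leRHS]mulrC divfK ?pnatr_eq0 -?lt0n// -natr1 mulrDl mul1r.
by move=> ? /andP[? ?]; apply/andP; split; lra.
Qed.

Section DyadicDescent.
Variables (R : realType) (n : nat) (K : set 'rV[R]_n.+1) (delta : R).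
Hypotheses (delta0 : 0 < delta) (delta1 : 2 * delta < 1).
Variable A : R -> set 'rV[R]_n.+1.
Hypothesis AS : forall r, A r `<=` spread K delta r.

Let k : R := n.+1%:R.
Let k1 : 1 <= k. Proof. by rewrite ler1n. Qed.
Let C : R := 32 * k * density n delta.

Let C0 : 0 <= C.
Proof.
have := density_ge1 n delta; move: k1 => ? ?; rewrite /C !mulr_ge0//; lra.
Qed.

Lemma scale_sup_ge0 (rho : R) Q : 0 < rho -> (0 <= scale_sup A rho Q)%E.
Proof.
move=> rho0; apply: (le_trans (leb_outer_ge0 (A rho `&` Q))).
apply: ereal_sup_ubound; exists rho => //=; apply/andP; split; lra.
Qed.

(** Shells whose lower end is at least [8 k l] miss the cube. The others contribute at most [t]
    times their scale, and those scales sum to at most [32 k l]. *)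
Lemma scale_sum_far (p : nat) (rho l : R) c : 0 < rho -> 0 < l ->
  (forall r x, A r x -> cube c l x -> r <= rho -> r <= 8 * k * l) ->
  3 * k * l <= dist_to K c ->
  (\sum_(m < p) scale_sup A (rho / 2 ^+ m) (cube c l) <= (C * l ^+ n.+1)%:E)%E.
Proof.
move=> rho0 l0 Al fc.
have d1 := density_ge1 n delta.
have ln0 : 0 < l ^+ n.+1 by rewrite exprn_gt0.
have kl0 : 0 < k * l by rewrite mulr_gt0//; exact: lt_le_trans k1.
have X0 : 0 < 16 * k * l by lra.
pose t := density n delta * l ^+ n.+1 / l.
have t0 : 0 <= t by rewrite divr_ge0 ?mulr_ge0 ?ltW//; lra.
apply: (@le_trans _ _ (\sum_(m < p) (t *
    (if rho / 2 ^+ m < 16 * k * l then rho / 2 ^+ m else 0))%:E)%E).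
  apply: lee_sum => m _; have m0 : 0 < rho / 2 ^+ m by rewrite divr_gt0// exprn_gt0.
  apply: ge_ereal_sup => _ [r /andP[r1 r2] <-].
  have r0 : 0 < r by lra.
  case: ltP => h.
    apply: (@le_trans _ _ (density n delta * (r / l) * l ^+ n.+1)%:E).
      apply: le_trans (spread_outer_le delta0 delta1 l0 r0 fc).
      by apply: le_leb_outer => x [/AS].
    rewrite lee_fin /t (_ : density n delta * (r / l) * l ^+ n.+1 =
      density n delta * l ^+ n.+1 / l * r); last by ring.
    by apply: ler_wpM2l.
  rewrite mulr0 (_ : _ `&` _ = set0) ?leb_outer0//.
  rewrite -subset0 => x [Ax Qx].
  have : r <= rho.
    apply: le_trans r2 _; rewrite ler_pdivrMr ?exprn_gt0//.
    by apply: ler_peMr; [exact: ltW | rewrite exprn_ege1// ler1n].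
  by move=> /(Al r x Ax Qx); lra.
rewrite sumEFin lee_fin -mulr_sumr.
apply: (@le_trans _ _ (t * (2 * (16 * k * l)))).
  apply: ler_wpM2l => //; apply: le_trans (dyadic_sum_le _ rho0 X0) _.
  by rewrite ler_pM2l// ge_min lexx orbT.
rewrite /t /C (_ : density n delta * l ^+ n.+1 / l * (2 * (16 * k * l)) =
  32 * k * density n delta * l ^+ n.+1 * (l / l)); last by ring.
by rewrite divff ?lt0r_neq0// mulr1.
Qed.

(** On the cube [f < 4 k l], which is at most the lower end of each of the [p] shells, so [r < f]
    fails there. This is where the halving stops. *)
Lemma scale_sum_near0 (p : nat) (rho l : R) c : 0 < rho -> 0 < l ->
  4 * k * l <= rho / 2 ^+ p -> dist_to K c < 3 * k * l ->
  (\sum_(m < p) scale_sup A (rho / 2 ^+ m) (cube c l) <= 0)%E.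
Proof.
move=> rho0 l0 pl fc; apply: sume_le0 => m _; apply: ge_ereal_sup => _ [r /andP[r1 r2] <-].
rewrite (_ : _ `&` _ = set0) ?leb_outer0//; rewrite -subset0 => x [/AS[_ rx _] Qx].
have xc : enorm (x - c) <= k * l.
  apply: enorm_le_coord => [|i]; first exact: ltW.
  have := Qx i; rewrite !mxE => /andP[? ?].
  by rewrite ler_norml; apply/andP; split; lra.
have := dist_to_lip K x c.
have : rho / 2 ^+ p <= rho / 2 ^+ m / 2.
  rewrite -mulrA -invfM -exprSr ler_pM2l// lef_pV2 ?posrE ?exprn_gt0//.
  by rewrite ler_weXn2l// ?ler1n.
by lra.
Qed.

(** Induction on the number [d] of halvings that bring the side down to the smallest scale
    considered. The [2^(n+1)] subcubes have the total volume of the cube, so [C] does not grow. *)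
Lemma scale_sum_le (d p : nat) (rho l : R) c : 0 < rho -> 0 < l ->
  (forall r x, A r x -> cube c l x -> r <= rho -> r <= 8 * k * l) ->
  4 * k * l <= rho / 2 ^+ p * 2 ^+ d ->
  (\sum_(m < p) scale_sup A (rho / 2 ^+ m) (cube c l) <= (C * l ^+ n.+1)%:E)%E.
Proof.
move=> rho0; elim: d l c => [|d IH] l c l0 Al pl.
  have [fc|fc] := ltP (dist_to K c) (3 * k * l); last exact: scale_sum_far.
  apply: (@le_trans _ _ 0%E).
    by apply: scale_sum_near0 => //; rewrite expr0 mulr1 in pl.
  by rewrite lee_fin mulr_ge0// exprn_ge0// ltW.
have [fc|fc] := ltP (dist_to K c) (3 * k * l); last exact: scale_sum_far.
have l20 : 0 < l / 2 by rewrite divr_gt0.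
pose Q (q : {ffun 'I_n.+1 -> 'I_2}) := subcube c l q.
apply: (@le_trans _ _ (\sum_(m < p) \sum_(q : {ffun 'I_n.+1 -> 'I_2})
    scale_sup A (rho / 2 ^+ m) (Q q))%E).
  apply: lee_sum => m _; apply: ge_ereal_sup => _ [r rm <-].
  apply: (@le_trans _ _ (\sum_(q : {ffun 'I_n.+1 -> 'I_2}) leb_outer (A r `&` Q q))%E).
    apply: leb_outer_fin_cover => x [Ax Qx].
    by have [q xq] := cube_cover (ltW l0) (ltn0Sn 1) Qx; exists q.
  by apply: lee_sum => q _; apply: ereal_sup_ubound; exists r.
rewrite exchange_big/=.
apply: (@le_trans _ _ (\sum_(q : {ffun 'I_n.+1 -> 'I_2}) (C * (l / 2) ^+ n.+1)%:E)%E).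
  apply: lee_sum => q _; apply: IH => //; last by rewrite exprSr in pl; lra.
  (* On the parent cube [r < f < 4 k l = 8 k (l / 2)], so the subcubes inherit the restriction on
     scales. *)
  move=> r x /AS[_ rx _] /(subcube_sub (ltW l0)) Qx _.
  have xc : enorm (x - c) <= k * l.
    apply: enorm_le_coord => [|i]; first exact: ltW.
    have := Qx i; rewrite !mxE => /andP[? ?].
    by rewrite ler_norml; apply/andP; split; lra.
  by have := dist_to_lip K x c; lra.
rewrite sumEFin lee_fin sumr_const card_ffun !card_ord -[leLHS]mulr_natl natrX.
by rewrite mulrCA -exprMn mulrCA divff ?mulr1// pnatr_eq0.
Qed.

Lemma scale_sum_bound (p : nat) (rho l : R) c : 0 < rho -> 0 < l ->
  rho <= 8 * k * l ->
  (\sum_(m < p) scale_sup A (rho / 2 ^+ m) (cube c l) <= (C * l ^+ n.+1)%:E)%E.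
Proof.
move=> rho0 l0 rl.
have p0 : 0 < rho / 2 ^+ p by rewrite divr_gt0// exprn_gt0.
pose d := (Num.truncn (4 * k * l / (rho / 2 ^+ p))).+1.
apply: (@scale_sum_le d) => // [r x _ _ rr|]; first exact: le_trans rl.
rewrite [leRHS]mulrC -ler_pdivrMr//; apply: le_trans (ltW (truncnS_gt _)) _.
by rewrite -[2 ^+ d]natrX ler_nat ltnW// ltn_expl.
Qed.

End DyadicDescent.

(** * Bounding the integral by a sum over dyadic shells *)

Section LowerIntegral.
Variable R : realType.

(* No measurability is needed: the integral is a supremum over the simple functions below the integrand. *)
Lemma ge0_le_integral_any d (T : measurableType d) (mu : {measure set T -> \bar R})
    (D : set T) (f g : T -> \bar R) :
  (forall x, D x -> 0 <= f x <= g x)%E ->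
  (\int[mu]_(x in D) f x <= \int[mu]_(x in D) g x)%E.
Proof.
move=> fg; rewrite !ge0_integralE; try by move=> x /fg /andP[? ?] //; exact: le_trans (_ : f x <= g x)%E.
apply: ereal_sup_le => _ [h /= hf <-]; exists h => //= x.
apply: le_trans (hf x) _; rewrite /patch; by case: ifPn => // /set_mem /fg /andP[].
Qed.

Lemma dyadic_integral_le (a : nat -> R) (rho L C : R) (f : R -> \bar R) :
  0 < rho -> L <= rho -> (forall m, 0 <= a m) ->
  (forall r, 0 < r -> (0 <= f r)%E) ->
  (forall m r, rho / 2 ^+ m / 2 < r <= rho / 2 ^+ m -> (f r <= (a m)%:E)%E) ->
  (forall p, \sum_(m < p) a m <= C) ->
  (\int[lebesgue_measure]_(r in `]0%R, L[%classic) (f r * (r^-1)%:E) <= C%:E)%E.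
Proof.
move=> rho0 Lrho a0 f0 fa aC.
pose s m := rho / 2 ^+ m.
have s0 m : 0 < s m by rewrite divr_gt0// exprn_gt0.
pose I m : set R := `]s m / 2, s m]%classic.
(* On the shell [r^-1 <= 2 / s m], and the shell has length [s m / 2]; so this measurable majorant
   has integral at most [a m]. *)
pose g m (r : R) : \bar R := ((a m * (2 / s m))%:E * (\1_(I m) r)%:E)%E.
have c0 m : 0 <= a m * (2 / s m) by rewrite mulr_ge0// divr_ge0// ltW.
have g0 m r : (0 <= g m r)%E by rewrite /g -EFinM lee_fin mulr_ge0.
have mI m : measurable (I m : set (measurableTypeR R)) by exact: measurable_itv.
have mD : measurable (`]0%R, L[%classic : set (measurableTypeR R)).
  exact: measurable_itv.
apply: (@le_trans _ _ (\int[lebesgue_measure]_(r in `]0%R, L[%classic)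
    (\sum_(0 <= m <oo) g m r))%E).
  apply: ge0_le_integral_any => r /=; rewrite in_itv/= => /andP[r0 rL].
  have ri : 0 <= r^-1 by rewrite invr_ge0 ltW.
  rewrite mule_ge0 ?lee_fin ?f0//=.
  have [m sm] := dyadic_shell r0 (le_trans (ltW rL) Lrho).
  apply: (@le_trans _ _ (g m r)); last first.
    apply: le_trans (nneseries_lim_ge m.+1 _) => //.
    by rewrite big_nat_recr//= leeDr// sume_ge0.
  rewrite /g indicE mem_set/= ?mule1; last by rewrite /I/= in_itv.
  apply: (@le_trans _ _ ((a m)%:E * (r^-1)%:E)%E).
    by apply: lee_wpmul2r; [rewrite lee_fin | exact: fa].
  rewrite -EFinM lee_fin; apply: ler_wpM2l => //.
  rewrite -[2 / s m]invf_div lef_pV2 ?posrE ?divr_gt0//.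
  by have /andP[/ltW] := sm.
rewrite integral_nneseries//; last first.
  move=> m; apply: emeasurable_funM => //; apply/measurable_EFinP.
  exact: measurable_indic.
apply: lime_le.
  by apply: is_cvg_nneseries => m _ _; apply: integral_ge0.
apply: nearW => p; rewrite big_mkord.
apply: (@le_trans _ _ (\sum_(m < p) (a m)%:E)%E); last by rewrite sumEFin lee_fin.
apply: lee_sum => m _; rewrite ge0_integralZl_EFin//; last first.
  by apply/measurable_EFinP; exact: measurable_indic.
rewrite integral_indic//.
apply: (@le_trans _ _ ((a m * (2 / s m))%:E * lebesgue_measure (I m))%E).
  apply: lee_wpmul2l; first by rewrite lee_fin.
  by apply: le_measure; rewrite ?inE//; exact: measurableI.
rewrite lebesgue_measure_itv/= lte_fin ltr_pdivrMr// mulr2n mulrDr mulr1 ltrDl s0.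
rewrite -EFinB -EFinM lee_fin (_ : a m * _ * _ = a m)//.
have := lt0r_neq0 (s0 m) => ?; by field.
Qed.

End LowerIntegral.

(** * Measurability *)

Section Continuity.
Variables (R : realType) (n k : nat).
Implicit Types p q : 'rV[R]_n -> 'rV[R]_k.

Definition coord_cont p := forall i, continuous (fun y => p y 0 i).

Lemma continuous_edot p q : coord_cont p -> coord_cont q ->
  continuous (fun y => edot (p y) (q y)).
Proof.
move=> cp cq; apply: continuous_big; first exact: add_continuous.
by move=> i _ y; apply: continuousM; [exact: cp | exact: cq].
Qed.

Lemma continuous_enorm p : coord_cont p -> continuous (fun y => enorm (p y)).
Proof.
move=> cp y; apply: (@continuous_comp _ _ _ (fun y => edot (p y) (p y)) Num.sqrt).
  exact: continuous_edot.
exact: sqrt_continuous.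
Qed.

Lemma coord_contB p (w : 'rV[R]_k) : coord_cont p -> coord_cont (fun y => p y - w).
Proof.
move=> cp i y; under eq_fun do rewrite !mxE.
exact: (continuousB (cp i y) (@cst_continuous _ _ (w 0 i) y)).
Qed.

Lemma coord_contN p (w : 'rV[R]_k) : coord_cont p -> coord_cont (fun y => w - p y).
Proof.
move=> cp i y; under eq_fun do rewrite !mxE.
exact: (continuousB (@cst_continuous _ _ (w 0 i) y) (cp i y)).
Qed.

Lemma continuous_dist_to (K : set 'rV[R]_k) p : coord_cont p ->
  continuous (fun y => dist_to K (p y)).
Proof.
move=> cp y0; apply/(@cvgrPdist_lt _ _ _ (nbhs (y0 : 'rV[R]_n)) (nbhs_filter (y0 : 'rV[R]_n))) => e e0.
have c0 : continuous (fun y => enorm (p y - p y0)).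
  exact/continuous_enorm/coord_contB.
have := c0 y0; move/cvgrPdist_lt => /(_ e e0); apply: filterS => y.
have -> : enorm (p y0 - p y0) = 0.
  by rewrite subrr /enorm /edot big1 ?sqrtr0// => i _; rewrite mxE mul0r.
rewrite sub0r normrN ger0_norm ?enorm_ge0// => h; apply: le_lt_trans h.
have := dist_to_lip K (p y) (p y0); have := dist_to_lip K (p y0) (p y).
by rewrite (enormB (p y0)) ler_norml => ? ?; apply/andP; split; lra.
Qed.

Lemma open_lt_continuous (u v : 'rV[R]_n -> R) :
  continuous u -> continuous v -> open [set y | u y < v y].
Proof.
move=> cu cv; rewrite (_ : mkset _ = (fun y => v y - u y) @^-1` [set t | 0 < t]).
  apply: open_comp; last exact: open_gt.
  by move=> y _; apply: continuousB; [exact: cv | exact: cu].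
by apply/seteqP; split=> y /=; rewrite subr_gt0.
Qed.

End Continuity.

Section Measurability.
Variables (R : realType) (k : nat) (K : set 'rV[R]_k.+1) (delta eps : R).
Hypotheses (delta0 : 0 < delta) (eps0 : 0 <= eps) (de : 2 * delta + eps < 1).

Notation V := 'rV[R]_(k.+1 + 1).
Let px (y : V) : 'rV[R]_k.+1 := lsubmx y.
Let pr (y : V) : R := y 0 (rshift k.+1 ord0).
Let c : R := 2 * ((1 - (2 * delta + eps)) / (1 + 2 * delta)) ^+ 2 - 1.
Let f (y : V) := dist_to K (px y).

Let ptK (y : V) : pt (px y) (pr y) = y.
Proof.
rewrite /pt /px; rewrite -[RHS]hsubmxK; congr row_mx.
by apply/rowP => i; rewrite !mxE (ord1 i).
Qed.

Let px_pt x (r : R) : px (pt x r) = x. Proof. exact: row_mxKl. Qed.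
Let pr_pt (x : 'rV[R]_k.+1) (r : R) : pr (pt x r) = r.
Proof. by rewrite /pr /pt row_mxEr mxE. Qed.

Lemma setG_imageE : [set pt p.1 p.2 | p in setG K eps delta] =
  [set y | setG K eps delta (px y, pr y)].
Proof.
apply/seteqP; split=> [_ [[x r] Gxr <-]|y Gy] /=; first by rewrite px_pt pr_pt.
by exists (px y, pr y) => //=; rewrite ptK.
Qed.

(** Strict inequalities, with the angle expressed by inner products, make this a union of open
    sets. *)
Definition strictG : set V := \bigcup_(z in K `*` K)
  ([set y | 0 < pr y] `&` [set y | pr y < f y] `&`
   [set y | enorm (px y - z.1) < f y + eps * pr y] `&`
   [set y | enorm (px y - z.2) < f y + eps * pr y] `&`
   [set y | edot (z.1 - px y) (z.2 - px y) <
            c * (enorm (px y - z.1) * enorm (px y - z.2))]).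

Let px_cont : coord_cont px.
Proof.
move=> i y; under eq_fun do rewrite mxE.
exact: coord_continuous.
Qed.

Let pr_cont : continuous pr.
Proof. exact: coord_continuous. Qed.

Let f_cont : continuous f.
Proof. exact: continuous_dist_to. Qed.

Lemma open_strictG : open strictG.
Proof.
have mulC (a : R) (u : V -> R) : continuous u -> continuous (fun y => a * u y).
  by move=> cu y; exact: (continuousM (@cst_continuous _ _ a y) (cu y)).
have near_cont : continuous (fun y => f y + eps * pr y).
  by move=> y; apply: continuousD; [exact: f_cont | exact: mulC].
have dist_cont z : continuous (fun y => enorm (px y - z)).
  exact/continuous_enorm/coord_contB.
apply: bigcup_open => -[z1 z2] _; do ![apply: openI]; apply: open_lt_continuous => //.
- exact: cst_continuous.
- by apply: continuous_edot; exact: coord_contN.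
- by apply: mulC => y; exact: (continuousM (dist_cont z1 y) (dist_cont z2 y)).
Qed.

(** Adding the region [r >= f] makes the set stable under raising [r]: the near-minimizer bounds
    only loosen until [r] reaches [f]. *)
Let H : set V := strictG `|` ~` [set y | pr y < f y].

Lemma leb_measurable_strictG : leb_measurable strictG.
Proof. exact: (@leb_measurable_open R (k + 1) _ open_strictG). Qed.

Lemma leb_measurable_H : leb_measurable H.
Proof.
apply: (@leb_measurableU R (k + 1)); first exact: leb_measurable_strictG.
apply/(@leb_measurableC R (k + 1))/(@leb_measurable_open R (k + 1)).
exact: open_lt_continuous.
Qed.

Let e : V := delta_mx 0 (rshift k.+1 ord0).

Let px_shift y (t : R) : px (y + t *: e) = px y.
Proof.
apply/rowP => i; rewrite !mxE /= (_ : _ == _ = false) ?mulr0 ?addr0//.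
by rewrite eq_lrshift.
Qed.

Let pr_shift y (t : R) : pr (y + t *: e) = pr y + t.
Proof. by rewrite /pr !mxE !eqxx mulr1. Qed.

Let c_itv : -1 <= c <= 1 - 4 * delta.
Proof. exact: angle_bound_itv. Qed.

Let setGP y : setG K eps delta (px y, pr y) ->
  [/\ 0 < pr y, pr y < f y & exists z, [/\ K z.1, K z.2,
    enorm (px y - z.1) <= f y + eps * pr y, enorm (px y - z.2) <= f y + eps * pr y &
    edot (z.1 - px y) (z.2 - px y) < c * (enorm (px y - z.1) * enorm (px y - z.2))]].
Proof.
case=> /= r0 rx [z1 [z2 [Kz1 Kz2]]].
move: rx; rewrite (edist_setE _ Kz1) -EFinD !lee_fin lte_fin => rx xz1 xz2.
have d1 := dist_to_le (px y) Kz1; have d2 := dist_to_le (px y) Kz2.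
have /andP[c1 c2] := c_itv.
have r1 : 0 < enorm (px y - z1) by apply: lt_le_trans d1; exact: lt_trans rx.
have r2 : 0 < enorm (px y - z2) by apply: lt_le_trans d2; exact: lt_trans rx.
have c_le1 : -1 <= c <= 1.
  by rewrite c1 (le_trans c2)// gerBl mulr_ge0// ltW.
have -> := seg_angle_gt c_le1 r1 r2.
by move=> ang; split=> //; exists (z1, z2).
Qed.

Let strictG_sub y : strictG y -> setG K eps delta (px y, pr y).
Proof.
case=> -[z1 z2] /= [Kz1 Kz2] [[[[r0 rx] xz1] xz2] ang].
have d1 := dist_to_le (px y) Kz1; have d2 := dist_to_le (px y) Kz2.
have /andP[c1 c2] := c_itv.
have r1 : 0 < enorm (px y - z1) by apply: lt_le_trans d1; exact: lt_trans rx.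
have r2 : 0 < enorm (px y - z2) by apply: lt_le_trans d2; exact: lt_trans rx.
split=> //=; first by rewrite (edist_setE _ Kz1) lte_fin.
exists z1, z2; rewrite (edist_setE _ Kz1) -EFinD !lee_fin; split=> //; try exact: ltW.
have c_le1 : -1 <= c <= 1.
  by rewrite c1 (le_trans c2)// gerBl mulr_ge0// ltW.
by have -> := seg_angle_gt c_le1 r1 r2.
Qed.

(** Raising [r] by [t > 0] adds [eps t > 0] of slack, which makes the near-minimizer bounds strict.
    So every upward translate of [N] lies in [H], and [leb_outer_boundary_null] applies. *)
Lemma setG_measurable_pos : 0 < eps ->
  leb_measurable [set y | setG K eps delta (px y, pr y)].
Proof.
move=> eps_gt0.
pose N : set V := [set y | setG K eps delta (px y, pr y)] `\` strictG.
have -> : [set y | setG K eps delta (px y, pr y)] = strictG `|` N.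
  apply/seteqP; split=> [y Gy|y [/strictG_sub//|[]//]].
  by have [?|?] := pselect (strictG y); [left | right].
apply: (@leb_measurableU R (k + 1)); first exact: leb_measurable_strictG.
apply/(@leb_measurable_null R (k + 1)).
apply: (@leb_outer_boundary_null R (k + 1) H N (rshift k.+1 ord0)).
- exact: leb_measurable_H.
- move=> y t t0 [[z Kz [[[[r0 rx] xz1] xz2] ang]]|nrx]; last first.
    right; rewrite /= -/e pr_shift /f px_shift => ?; apply: nrx => /=.
    by rewrite /f; lra.
  rewrite -/e; have [rt|rt] := ltP (pr y + t) (f y); last first.
    by right; rewrite /= pr_shift /f px_shift; apply/negP; rewrite -leNgt.
  have et : 0 <= eps * t by rewrite mulr_ge0// ltW.
  left; exists z => //; rewrite /= /f !px_shift !pr_shift -/(f y) mulrDr.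
  by move: r0 rx xz1 xz2 ang => /= *; do !split=> //; lra.
- move=> y [Gy nGy] [//|]; apply; by case: (setGP Gy).
- move=> y t t0 [/setGP[r0 rx [z [Kz1 Kz2 xz1 xz2 ang]]] _].
  rewrite -/e; have [rt|rt] := ltP (pr y + t) (f y); last first.
    by right; rewrite /= pr_shift /f px_shift; apply/negP; rewrite -leNgt.
  have et : 0 < eps * t by rewrite mulr_gt0.
  left; exists z => //; rewrite /= /f !px_shift !pr_shift -/(f y) mulrDr.
  by do !split=> //; lra.
Qed.

End Measurability.

(** * The case [eps = 0] and the Carleson estimate *)

Section CarlesonSet.
Variables (R : realType) (n : nat).
Implicit Types (K : set 'rV[R]_n.+1) (delta eps : R).

Let k : R := n.+1%:R.

Lemma slice_setG_spread K delta eps r : 0 < delta -> 0 <= eps -> 2 * delta + eps < 1 ->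
  slice (setG K eps delta) r `<=` spread K delta r.
Proof. by move=> ? ? ? x; exact: setG_spread. Qed.

(** With [eps = 0] the scale enters only through [0 < r < d(x,K)]. *)
Lemma slice_setG_eps0 K delta r s : 0 < s -> s <= r ->
  slice (setG K 0 delta) r `<=` slice (setG K 0 delta) s.
Proof.
move=> s0 sr x [/= r0 rx]; rewrite mul0r => zs.
split=> //=; last by rewrite mul0r.
by apply: le_lt_trans rx; rewrite lee_fin.
Qed.

(** The slices at all smaller scales contain this one, so each of the [p] dyadic terms is at least
    [v], and [p v <= C] for every [p]. *)
Lemma slice_setG_eps0_null K delta r c (l : R) :
  0 < delta -> 2 * delta < 1 -> 0 < r -> 0 < l ->
  leb_outer (slice (setG K 0 delta) r `&` cube c l) = 0%E.
Proof.
move=> delta0 delta1 r0 l0; set v := leb_outer _.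
pose A s := slice (setG K 0 delta) s.
have AS s : A s `<=` spread K delta s by apply: slice_setG_spread; rewrite ?addr0.
have kl0 : 0 < 8 * k * l by rewrite !mulr_gt0.
pose rho := Num.min r (8 * k * l).
have rho0 : 0 < rho by rewrite lt_min r0.
have rhol : rho <= 8 * k * l by rewrite ge_min lexx orbT.
pose C := 32 * k * density n delta * l ^+ n.+1.
have vC p : (\sum_(m < p) v <= C%:E)%E.
  apply: le_trans (scale_sum_bound delta0 delta1 AS p c rho0 l0 rhol).
  apply: lee_sum => m _.
  have m0 : 0 < rho / 2 ^+ m by rewrite divr_gt0// exprn_gt0.
  apply: (@le_trans _ _ (leb_outer (A (rho / 2 ^+ m) `&` cube c l))).
    apply: le_leb_outer; apply: setSI; apply: slice_setG_eps0 => //.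
    apply: (@le_trans _ _ rho); last by rewrite ge_min lexx.
    rewrite ler_pdivrMr ?exprn_gt0//.
    by apply: ler_peMr; [exact: ltW | rewrite exprn_ege1// ler1n].
  apply: ereal_sup_ubound; exists (rho / 2 ^+ m) => //=.
  by rewrite lexx andbT ltr_pdivrMr//; lra.
have v0 : (0 <= v)%E by exact: leb_outer_ge0.
have vfin : v \is a fin_num.
  rewrite ge0_fin_numE//; apply: le_lt_trans (ltry C).
  by have := vC 1%N; rewrite big_ord1.
move: vC v0; rewrite -(fineK vfin) => vC; rewrite lee_fin => v0.
congr (_%:E); apply/eqP; rewrite eq_le v0 andbT leNgt; apply/negP => v_gt0.
have := vC (Num.truncn (C / fine v)).+1; apply/negP; rewrite -ltNge.
rewrite sumEFin lte_fin sumr_const card_ord -[ltRHS]mulr_natl -ltr_pdivrMr//.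
exact: truncnS_gt.
Qed.

Lemma setG_eps0_null K delta : 0 < delta -> 2 * delta < 1 ->
  leb_outer [set pt p.1 p.2 | p in setG K 0 delta] = 0%E.
Proof.
move=> delta0 delta1.
pose A (j : nat) := slice (setG K 0 delta) j.+1%:R^-1 `&`
  cube (const_mx (- j.+1%:R)) (2 * j.+1%:R).
pose F (j : nat) := [set pt p.1 p.2 | p in [set p | A j p.1 /\ `|p.2| <= j.+1%:R]].
apply: (@leb_outer_subset_null R (n + 1) _ (\bigcup_j F j)).
  move=> _ [[x r] Gxr <-] /=.
  have r0 : 0 < r by case: Gxr.
  (* One index above [r^-1], [r] and every coordinate puts the point in [F j]. *)
  pose M := r^-1 + r + \sum_i `|x 0 i|.
  have ri0 : 0 < r^-1 by rewrite invr_gt0.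
  have sum0 : 0 <= \sum_i `|x 0 i| by exact: sumr_ge0.
  set j := Num.truncn M; have Mj : M < j.+1%:R by exact: truncnS_gt.
  exists j => //; exists (x, r) => //=; split; last first.
    by rewrite gtr0_norm//; move: Mj; rewrite /M; lra.
  split=> [|i].
    apply: slice_setG_eps0 Gxr; first by rewrite invr_gt0.
    by rewrite -[leRHS]invrK lef_pV2 ?posrE//; move: Mj; rewrite /M; lra.
  have : `|x 0 i| <= \sum_i `|x 0 i| by rewrite (bigD1 i)//= lerDl sumr_ge0.
  move: Mj; rewrite /M !mxE; move: (j.+1%:R) => J ? h.
  have : `|x 0 i| <= J by lra.
  by rewrite ler_norml => /andP[? ?]; apply/andP; split; lra.
apply: (@leb_outer_null_bigcup R (n + 1)) => j.
by apply: leb_outer_cylinder_null; exact: slice_setG_eps0_null.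
Qed.

Lemma setG_measurable K delta eps :
  0 < delta -> 0 <= eps -> 2 * delta + eps < 1 ->
  leb_measurable [set pt p.1 p.2 | p in setG K eps delta].
Proof.
move=> delta0; rewrite le_eqVlt => /predU1P[<-|eps_gt0] de.
  apply: (@leb_measurable_null R (n + 1)); apply: setG_eps0_null => //.
  by rewrite addr0 in de.
by rewrite setG_imageE; apply: setG_measurable_pos => //; exact: ltW.
Qed.

Lemma eball_sub_cube (c : 'rV[R]_n.+1) (L : R) : eball c L `<=` cube (c - const_mx L) (2 * L).
Proof.
move=> x xc i; have := le_lt_trans (coord_le_enorm (x - c) i) xc.
by rewrite !mxE ltr_norml => /andP[? ?]; apply/andP; split; lra.
Qed.

(** The cube of side [L / k] centred at [c] stays within distance [L / 2] of [c]. *)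
Lemma leb_outer_eball_ge (c : 'rV[R]_n.+1) (L : R) : 0 < L ->
  (((L / k) ^+ n.+1)%:E <= leb_outer (eball c L))%E.
Proof.
move=> L0; have k0 : 0 < k by rewrite ltr0n.
have Lk : 0 < L / k by rewrite divr_gt0.
rewrite -(cube_vol (c - const_mx (L / k / 2)) (ltW Lk)).
apply: le_trans (box_vol_le_leb_outer _ _) _; apply: le_leb_outer => x xc.
have : enorm (x - c) <= k * (L / k / 2).
  apply: enorm_le_coord => [|i]; first by rewrite divr_ge0// ltW.
  have := xc i; rewrite !mxE ler_norml; move: (L / k) => t /andP[? ?].
  by apply/andP; split; lra.
rewrite /eball /= mulrA mulrCA divff ?lt0r_neq0// mulr1 => h.
by apply: le_lt_trans h _; lra.
Qed.

(** The descent runs on a cube of side [2 L] around the ball. The ball has at least the volume of a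
    cube of side [L / k], whence the factor [(2 k)^(n+1)]. *)
Lemma setG_carleson_integral K delta eps (L : R) (c : 'rV[R]_n.+1) :
  0 < delta -> 0 <= eps -> 2 * delta + eps < 1 -> 0 < L ->
  (\int[lebesgue_measure]_(r in `]0%R, L[%classic)
      (leb_outer (slice (setG K eps delta) r `&` eball c L) * (r^-1)%:E)
   <= (32 * k * density n delta * (2 * k) ^+ n.+1)%:E * leb_outer (eball c L))%E.
Proof.
move=> delta0 eps0 de L0.
have delta1 : 2 * delta < 1 by lra.
have k1 : 1 <= k by rewrite ler1n.
have d1 := density_ge1 n delta.
pose A r := slice (setG K eps delta) r.
have AS r : A r `<=` spread K delta r by exact: slice_setG_spread.
have l0 : 0 < 2 * L by rewrite mulr_gt0.
pose Q := cube (c - const_mx L) (2 * L).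
pose C := 32 * k * density n delta * (2 * L) ^+ n.+1.
have lk : 2 * L <= 8 * k * (2 * L) by apply: ler_peMl; [exact: ltW | lra].
have sumC p : (\sum_(m < p) scale_sup A (2 * L / 2 ^+ m) Q <= C%:E)%E.
  exact: (scale_sum_bound delta0 delta1 AS p _ l0 l0 lk).
have m0 m : 0 < 2 * L / 2 ^+ m by rewrite divr_gt0// exprn_gt0.
have E0 m : (0 <= scale_sup A (2 * L / 2 ^+ m) Q)%E by exact: scale_sup_ge0.
have Efin m : scale_sup A (2 * L / 2 ^+ m) Q \is a fin_num.
  rewrite ge0_fin_numE//; apply: le_lt_trans (ltry C).
  apply: le_trans (sumC m.+1); rewrite big_ord_recr/=.
  by rewrite leeDr// sume_ge0.
apply: (@le_trans _ _ C%:E).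
  apply: (@dyadic_integral_le _ (fun m => fine (scale_sup A (2 * L / 2 ^+ m) Q)) (2 * L)) => //.
  - by lra.
  - by move=> m; exact: fine_ge0.
  - by move=> r _; exact: leb_outer_ge0.
  - move=> m r rm; rewrite fineK//.
    apply: (@le_trans _ _ (leb_outer (A r `&` Q))).
      by apply: le_leb_outer; apply: setIS; exact: eball_sub_cube.
    by apply: ereal_sup_ubound; exists r.
  - move=> p; rewrite -lee_fin -sumEFin.
    by under eq_bigr => m _ do rewrite fineK//; exact: sumC.
apply: le_trans (lee_wpmul2l _ (leb_outer_eball_ge c L0)); last first.
  by rewrite lee_fin !mulr_ge0 ?exprn_ge0 ?mulr_ge0//; lra.
rewrite -EFinM lee_fin /C -[leRHS]mulrA -exprMn.
have -> : 2 * k * (L / k) = 2 * L by field; rewrite lt0r_neq0//; lra.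
by [].
Qed.

End CarlesonSet.

Theorem theorem1p3 (R : realType) (k : nat) (hk : (1 <= k)%N)
    (delta : R) (hdelta : 0 < delta) :
  exists C : R, forall (K : set 'rV[R]_k) (eps : R),
    0 <= eps -> 2 * delta + eps < 1 ->
    carleson_with_const (setG K eps delta) C.
Proof.
case: k hk => // n _.
(* [density] depends on [n] and [delta] alone, so the constant precedes [K] and [eps]. *)
exists (32 * n.+1%:R * density n delta * (2 * n.+1%:R) ^+ n.+1) => K eps eps0 de.
split.
- by move=> [x r] [].
- exact: setG_measurable.
- have := density_ge1 n delta => d1.
  by rewrite !mulr_ge0 ?exprn_ge0 ?mulr_ge0//; lra.
- by move=> L c L0; exact: setG_carleson_integral.
Qed.
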